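(* Let $N$ be a positive integer. The quotient $\operatorname{Norm}(\Gamma_0(N))/\Gamma_0(N)$ is a (not necessarily direct) product of the subgroups $G_2$, $G_3$ and $G_q$ ($q\ge 5$ prime, $q\mid N$), whose group structure is given by the following generators and relations (with the caveat on the case $\upsilon''=8$ stated in the context): (1) For every prime $q\ge 5$ with $q\mid N$: $G_q=\{w_{q^{v_q(N)}}\}$. (2) For the prime $3$: (a) If $v_3(N)=0$: $G_3=\{1\}$. (b) If $v_3(N)=1$: $G_3=\{w_3\}$. (c) If $v_3(N)=2$: $G_3=\{w_9,S_3\}$, satisfying $w_9^2=S_3^3=(w_9S_3)^3=1$ (factor of order $12$). (d) If $v_3(N)\ge 3$: $G_3=\{w_{3^{v_3(N)}},S_3\}$, where $w_{3^{v_3(N)}}^2=S_3^3=1$ and $w_{3^{v_3(N)}}S_3w_{3^{v_3(N)}}$ commutes with $S_3$ (factor group with $18$ elements). (3) For the prime $2$, let $\lambda=v_2(N)$, $\mu=\min(3,[\lambda/2])$ and $\upsilon''=2^{\mu}$. Then: (a) If $\lambda=0$: $G_2=\{1\}$. (b) If $\lambda=1$: $G_2=\{w_2\}$. (c) If $\lambda=2\mu$ and $2\le\lambda\le 6$: $G_2=\{w_{2^{\lambda}},S_{\upsilon''}\}$ with the relations $w_{2^{\lambda}}^2=S_{\upsilon''}^{\upsilon''}=(w_{2^{\lambda}}S_{\upsilon''})^3=1$, where these groups have orders $6$, $24$ and $96$ for $\upsilon''=2,4,8$ respectively. (d) If $\lambda>2\mu$ and $2\le\lambda\le 7$: $G_2=\{w_{2^{\lambda}},S_{\upsilon''}\}$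 with $w_{2^{\lambda}}^2=S_{\upsilon''}^{\upsilon''}=1$ and, moreover, $(w_{2^{\lambda}}S_{\upsilon''})^4=1$. ($\tilde c$),($\tilde d$) If $\lambda\ge 9$: $G_2=\{w_{2^{\lambda}},S_8\}$ with the relations $w_{2^{\lambda}}^2=S_8^8=1$ and $S_8$ commutes with $w_{2^{\lambda}}S_8w_{2^{\lambda}}$. ($\hat c$) If $\lambda=8$: $G_2=\{w_{256},S_8\}$ with the relations $w_{256}^2=S_8^8=1$ and $w_{256}S_8w_{256}S_8w_{256}S_8^3w_{256}S_8^3=1$.
   Context: $\Gamma_0(N)=\{\begin{pmatrix}a&b\\ Nc&d\end{pmatrix}\in SL_2(\mathbb{Z}) : c\in\mathbb{Z}\}$, and $\operatorname{Norm}(\Gamma_0(N))$ is its normalizer in $SL_2(\mathbb{R})$. $v_p(N)$ is the $p$-adic valuation of $N$, and $[x]$ is the integer part of $x$. For a divisor $m$ of $N$ with $\gcd(m,N/m)=1$, the Atkin-Lehner involution is $w_m=\frac{1}{\sqrt m}\begin{pmatrix}ma&b\\ Nc&md\end{pmatrix}\in SL_2(\mathbb{R})$ with $a,b,c,d\in\mathbb{Z}$; its class modulo $\Gamma_0(N)$ does not depend on the choice. For a positive integer $v'$, $S_{v'}=\begin{pmatrix}1&1/v'\\0&1\end{pmatrix}$. The matrices $w_m$ and $S_{v'}$ used in the claim lie in $\operatorname{Norm}(\Gamma_0(N))$; the same symbols denote their classes in $\operatorname{Norm}(\Gamma_0(N))/\Gamma_0(N)$, and all relations are relations in this quotient. Braces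 $\{\dots\}$ denote the subgroup of the quotient generated by the listed elements, and the listed relations (and orders, where given) are presented as describing the structure of that group. Caveat: when $\upsilon''=8$ (that is, $v_2(N)\ge 6$), the listed relations possibly do not completely define the group $G_2$. ''Product'' means that every element of the quotient is a product of elements of the listed subgroups; different subgroups need not commute with each other elementwise.
   Formalization: In (3)(d) with λ=5 (υ''=4) the listed relations are only claimed to hold, not to define G_2: they present the infinite (2,4,4) triangle group, while G_2 is finite. For λ=3 they are claimed to define G_2. *)

(* Defs.v *)
From HB Require Import structures.
From mathcomp Require Import all_boot all_order all_algebra.
From mathcomp Require Import mathcomp_extra boolp classical_sets functions.
From mathcomp Require Import cardinality reals.
From mathcomp Require Import ring.

Set Implicit Arguments.
Unset Strict Implicit.
Unset Printing Implicit Defensive.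

Import Order.TTheory GRing.Theory Num.Theory.

Local Open Scope ring_scope.
Local Open Scope quotient_scope.
Local Open Scope classical_set_scope.

Definition mx2 (R : Type) (a b c d : R) : 'M[R]_2 :=
  \matrix_(i < 2, j < 2)
    if i == 0 then (if j == 0 then a else b) else (if j == 0 then c else d).

Lemma mx2P (R : Type) (A : 'M[R]_2) :
  A = mx2 (A 0 0) (A 0 1) (A 1 0) (A 1 1).
Proof.
apply/matrixP => -[[|[|//]] i] [[|[|//]] j]; rewrite mxE /=;
  by congr (A _ _); apply: val_inj.
Qed.

Section Matrix2.
Variable R : comPzRingType.
Implicit Types a b c d : R.

Lemma mul_mx2 a b c d a' b' c' d' :
  mx2 a b c d *m mx2 a' b' c' d' =
  mx2 (a * a' + b * c') (a * b' + b * d') (c * a' + d * c') (c * b' + d * d').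
Proof.
by apply/matrixP => -[[|[|//]] i] [[|[|//]] j];
  rewrite !mxE !big_ord_recl big_ord0 addr0 !mxE.
Qed.

Lemma scale_mx2 x a b c d :
  x *: mx2 a b c d = mx2 (x * a) (x * b) (x * c) (x * d).
Proof. by apply/matrixP => -[[|[|//]] i] [[|[|//]] j]; rewrite !mxE. Qed.

Lemma scalar_mx2 a : a%:M = mx2 a 0 0 a.
Proof. by apply/matrixP => -[[|[|//]] i] [[|[|//]] j]; rewrite !mxE. Qed.

Lemma det_mx2 a b c d : \det (mx2 a b c d) = a * d - b * c.
Proof.
rewrite (expand_det_row _ 0) !big_ord_recl big_ord0 addr0 /cofactor !det_mx11.
by rewrite !mxE /= expr0 expr1 mul1r mulN1r mulrN.
Qed.

End Matrix2.

Section SL2.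
Variable R : fieldType.

Record SL2 := MkSL2 { SL2_mx :> 'M[R]_2; SL2_det : \det SL2_mx == 1 }.

HB.instance Definition _ := [isSub for SL2_mx].
HB.instance Definition _ := [Choice of SL2 by <:].

Lemma SL2_unit (A : SL2) : (A : 'M_2) \in unitmx.
Proof. by rewrite unitmxE (eqP (SL2_det A)) unitr1. Qed.

Fact SL2_one_subproof : \det (1%:M : 'M[R]_2) == 1.
Proof. by rewrite det1. Qed.

Fact SL2_mul_subproof (A B : SL2) : \det (A *m B) == 1.
Proof. by rewrite det_mulmx (eqP (SL2_det A)) (eqP (SL2_det B)) mulr1. Qed.

Fact SL2_inv_subproof (A : SL2) : \det (invmx A) == 1.
Proof. by rewrite det_inv (eqP (SL2_det A)) invr1. Qed.

Definition SL2_one := MkSL2 SL2_one_subproof.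
Definition SL2_mul A B := MkSL2 (SL2_mul_subproof A B).
Definition SL2_inv A := MkSL2 (SL2_inv_subproof A).

Fact SL2_mulA : associative SL2_mul.
Proof. by move=> A B C; apply: val_inj; rewrite /= mulmxA. Qed.
Fact SL2_mul1 : left_id SL2_one SL2_mul.
Proof. by move=> A; apply: val_inj; rewrite /= mul1mx. Qed.
Fact SL2_mulr1 : right_id SL2_one SL2_mul.
Proof. by move=> A; apply: val_inj; rewrite /= mulmx1. Qed.
Fact SL2_mulV : left_inverse SL2_one SL2_inv SL2_mul.
Proof. by move=> A; apply: val_inj; rewrite /= mulVmx ?SL2_unit. Qed.
Fact SL2_mulrV : right_inverse SL2_one SL2_inv SL2_mul.
Proof. by move=> A; apply: val_inj; rewrite /= mulmxV ?SL2_unit. Qed.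

HB.instance Definition _ :=
  isGroup.Build SL2 SL2_mulA SL2_mul1 SL2_mulr1 SL2_mulV SL2_mulrV.

Lemma SL2_mulE (A B : SL2) : ((A * B)%g : 'M_2) = A *m B.
Proof. by []. Qed.

Lemma SL2_invE (A : SL2) a b c d :
  (A : 'M_2) = mx2 a b c d -> ((A^-1)%g : 'M_2) = mx2 d (- b) (- c) a.
Proof.
move=> EA; have := SL2_det A; rewrite EA det_mx2 => /eqP dA.
rewrite /inv /= -[RHS]mul1mx -(mulVmx (SL2_unit A)) -mulmxA EA mul_mx2.
suff -> : mx2 (a * d + b * - c) (a * - b + b * a) (c * d + d * - c)
   (c * - b + d * a) = 1%:M :> 'M[R]_2 by rewrite mulmx1.
by rewrite scalar_mx2 -dA; congr (mx2 _ _ _ _); ring.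
Qed.

End SL2.

Section NormalizerQuotient.
Variables (R : realType) (N : nat).
Local Open Scope group_scope.

Definition in_Gamma0 (g : SL2 R) : Prop := exists a b c d : int,
  (g : 'M_2) = mx2 a%:~R b%:~R (N%:Z * c)%R%:~R d%:~R.

Definition Gamma0 : {pred SL2 R} := fun g => `[< in_Gamma0 g >].

Lemma Gamma0P g : reflect (in_Gamma0 g) (g \in Gamma0).
Proof. exact: asboolP. Qed.

Fact Gamma0_group : group_closed Gamma0.
Proof.
split; first by apply/Gamma0P; exists 1%R, 0%R, 0%R, 1%R; rewrite mulr0 -scalar_mx2.
move=> g h /Gamma0P[a [b [c [d Eg]]]] /Gamma0P[a' [b' [c' [d' Eh]]]].
apply/Gamma0P.
exists (a * d' - b * (N%:Z * c'))%R, (- a * b' + b * a')%R.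
exists (c * d' - d * c')%R, (- N%:Z * c * b' + d * a')%R.
rewrite SL2_mulE Eg (SL2_invE Eh) mul_mx2.
by congr (mx2 _ _ _ _); rewrite ?(rmorphD, rmorphN, rmorphM, rmorphB) /=; ring.
Qed.

HB.instance Definition _ := isMulClosed.Build _ Gamma0 (group_closedM Gamma0_group).
HB.instance Definition _ := isMul1Closed.Build _ Gamma0 (proj1 Gamma0_group).
HB.instance Definition _ := isInvClosed.Build _ Gamma0 (group_closedV Gamma0_group).

Definition NormGamma0 : {pred SL2 R} := fun g =>
  `[< forall h, (g * h * g^-1 \in Gamma0) = (h \in Gamma0) >].

Lemma NormGamma0P g :
  reflect (forall h, (g * h * g^-1 \in Gamma0) = (h \in Gamma0))
          (g \in NormGamma0).
Proof. exact: asboolP. Qed.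

Fact NormGamma0_group : group_closed NormGamma0.
Proof.
split; first by apply/NormGamma0P => h; rewrite mul1g invg1 mulg1.
move=> g k /NormGamma0P Ng /NormGamma0P Nk; apply/NormGamma0P => h.
have -> : g / k * h * (g / k)^-1 = g * (k^-1 * h * k) * g^-1.
  by rewrite invgF !mulgA.
by rewrite Ng -Nk !mulgA mulgV mul1g mulgK.
Qed.

Record Norm := MkNorm { Norm_val :> SL2 R; Norm_valP : Norm_val \in NormGamma0 }.

HB.instance Definition _ := [isSub for Norm_val].
HB.instance Definition _ := [Choice of Norm by <:].
HB.instance Definition _ :=
  SubChoice_isSubGroup.Build (SL2 R) NormGamma0 Norm NormGamma0_group.

Definition coset_rel : rel Norm := fun g h => val (g^-1 * h) \in Gamma0.

Fact coset_rel_refl : reflexive coset_rel.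
Proof. by move=> g; rewrite /coset_rel mulVg gpred1. Qed.
Fact coset_rel_sym : symmetric coset_rel.
Proof.
move=> g h; rewrite /coset_rel -(gpredV _ (val (g^-1 * h))).
by rewrite -gmulfV invgM invgK.
Qed.
Fact coset_rel_trans : transitive coset_rel.
Proof.
move=> h g k gh hk; rewrite /coset_rel.
have -> : g^-1 * k = (g^-1 * h) * (h^-1 * k) by rewrite mulgA mulgK.
by rewrite gmulfM gpredM.
Qed.

Canonical coset_equiv :=
  EquivRel coset_rel coset_rel_refl coset_rel_sym coset_rel_trans.

(* The quotient group Norm (Gamma0 N) / Gamma0 N; its elements are the classes
   of Norm under [coset_rel], and \pi is the projection. *)
Definition NQuot : Type := {eq_quot coset_equiv}.
HB.instance Definition _ := Choice.on NQuot.
HB.instance Definition _ := EqQuotient.on NQuot.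

Definition NQuot_one : NQuot := \pi 1.
Definition NQuot_mul := lift_op2 NQuot (fun g h : Norm => g * h).
Definition NQuot_inv := lift_op1 NQuot (fun g : Norm => g^-1).

Lemma NQuot_eq (g h : Norm) :
  (\pi g == \pi h :> NQuot) = (val (g^-1 * h) \in Gamma0).
Proof. by rewrite eqmodE. Qed.

Lemma Norm_conj (g h : Norm) :
  (val (g * h * g^-1) \in Gamma0) = (val h \in Gamma0).
Proof. by rewrite !gmulfM gmulfV (NormGamma0P _ (Norm_valP g)). Qed.

Fact NQuot_mulE : {morph \pi_NQuot : g h / g * h >-> NQuot_mul g h}.
Proof.
unlock NQuot_mul => g h; apply/eqP; rewrite NQuot_eq.
have := NQuot_eq g (repr (\pi_NQuot g)); rewrite reprK eqxx => /esym Hg.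
have := NQuot_eq h (repr (\pi_NQuot h)); rewrite reprK eqxx => /esym Hh.
set g' := repr _ in Hg *; set h' := repr _ in Hh *.
have -> : (g * h)^-1 * (g' * h') =
    h^-1 * (g^-1 * g') * (h^-1)^-1 * (h^-1 * h').
  by rewrite invgM invgK !mulgA mulgK.
by rewrite gmulfM gpredM // Norm_conj.
Qed.
Canonical NQuot_mul_morph := PiMorph2 NQuot_mulE.

Fact NQuot_invE : {morph \pi_NQuot : g / g^-1 >-> NQuot_inv g}.
Proof.
unlock NQuot_inv => g; apply/eqP; rewrite NQuot_eq.
have := NQuot_eq g (repr (\pi_NQuot g)); rewrite reprK eqxx => /esym Hg.
set g' := repr _ in Hg *.
have -> : g^-1^-1 * g'^-1 = g * (g^-1 * g')^-1 * g^-1.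
  by rewrite invgM !invgK !mulgA mulgK.
by rewrite Norm_conj gmulfV gpredV.
Qed.
Canonical NQuot_inv_morph := PiMorph1 NQuot_invE.

Fact NQuot_mulA : associative NQuot_mul.
Proof.
elim/quotW=> x; elim/quotW=> y; elim/quotW=> z.
by rewrite -!NQuot_mulE mulgA.
Qed.
Fact NQuot_mul1 : left_id NQuot_one NQuot_mul.
Proof. by elim/quotW=> x; rewrite -NQuot_mulE mul1g. Qed.
Fact NQuot_mulr1 : right_id NQuot_one NQuot_mul.
Proof. by elim/quotW=> x; rewrite -NQuot_mulE mulg1. Qed.
Fact NQuot_mulV : left_inverse NQuot_one NQuot_inv NQuot_mul.
Proof. by elim/quotW=> x; rewrite -NQuot_invE -NQuot_mulE mulVg. Qed.
Fact NQuot_mulrV : right_inverse NQuot_one NQuot_inv NQuot_mul.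
Proof. by elim/quotW=> x; rewrite -NQuot_invE -NQuot_mulE mulgV. Qed.

HB.instance Definition _ := isGroup.Build NQuot
  NQuot_mulA NQuot_mul1 NQuot_mulr1 NQuot_mulV NQuot_mulrV.

Lemma pi_NQuotM (g h : Norm) : \pi_NQuot (g * h) = \pi_NQuot g * \pi_NQuot h.
Proof. exact: NQuot_mulE. Qed.

End NormalizerQuotient.

Section AtkinLehner.
Variables (R : realType) (N : nat).
Local Open Scope group_scope.

Definition AL_form (m : nat) (g : SL2 R) : Prop := exists a b c d : int,
  (g : 'M_2) = ((Num.sqrt m%:R)^-1 *:
    mx2 (m%:Z * a)%:~R b%:~R (N%:Z * c)%:~R (m%:Z * d)%:~R)%R.

Fact ALpos (m : nat) (g : SL2 R) : AL_form m g ->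
  let s : R := Num.sqrt m%:R in
  [/\ s != 0, s ^+ 2 = m%:R & exists a b c d : int, (g : 'M_2) =
    mx2 (s * a%:~R)%R (s^-1 * b%:~R)%R (s^-1 * N%:R * c%:~R)%R (s * d%:~R)%R]%R.
Proof.
move=> [a [b [c [d Eg]]]] s.
have m0 : (m%:R != 0 :> R)%R.
  apply/eqP => m0; have := SL2_det g.
  by rewrite Eg m0 sqrtr0 invr0 scale0r det0 eq_sym oner_eq0.
have m_ge0 : (0 <= m%:R :> R)%R by [].
have s2 := sqr_sqrtr m_ge0; rewrite -/s in s2 Eg.
have s0 : (s != 0)%R by apply: contraNneq m0 => s0; rewrite -s2 s0 expr0n.
split=> //; exists a, b, c, d; rewrite Eg scale_mx2.
by congr (mx2 _ _ _ _); rewrite ?rmorphM /= -?pmulrn -?s2; field.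
Qed.

Fact AL_conj (m : nat) (g h : SL2 R) : (m %| N)%N ->
  AL_form m g -> h \in Gamma0 N -> g * h * g^-1 \in Gamma0 N.
Proof.
move=> /dvdnP[M NE] /ALpos[]; set s := Num.sqrt _ => s0 s2 [a [b [c [d Eg]]]].
move=> /Gamma0P[p [q [r [t Eh]]]]; apply/Gamma0P.
have NR : (N%:R = M%:R * s ^+ 2 :> R)%R by rewrite s2 NE natrM.
pose m' : int := m; pose M' : int := M; pose N' : int := N.
exists (d * (m' * a * p + b * N' * r) - M' * c * (m' * a * q + b * t))%R.
exists (- b * (a * p + b * M' * r) + a * (m' * a * q + b * t))%R.
exists (d * (c * p + m' * d * r) - M' * c * c * q - c * d * t)%R.
exists (- b * M' * c * p - b * d * N' * r + a * (N' * c * q + m' * d * t))%R.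
rewrite !SL2_mulE Eg Eh (SL2_invE Eg) !mul_mx2.
by congr (mx2 _ _ _ _); rewrite ?(rmorphD, rmorphN, rmorphM, rmorphB) /=
   -?pmulrn ?NR -?s2; field.
Qed.

Fact AL_formV (m : nat) (g : SL2 R) : AL_form m g -> AL_form m g^-1.
Proof.
move=> [a [b [c [d Eg]]]]; exists d, (- b)%R, (- c)%R, a.
rewrite scale_mx2 in Eg; rewrite (SL2_invE Eg) scale_mx2.
by congr (mx2 _ _ _ _); rewrite ?(rmorphN, rmorphM) /=; ring.
Qed.

Lemma AL_Norm (m : nat) (g : SL2 R) : (m %| N)%N ->
  AL_form m g -> g \in NormGamma0 N.
Proof.
move=> mN ALg; apply/NormGamma0P => h; apply/idP/idP; last first.
  by move=> hG; exact: (AL_conj mN ALg hG).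
move=> /(AL_conj mN (AL_formV ALg)).
by rewrite invgK !mulgA mulVg mul1g mulgVK.
Qed.

Definition AL_class (m : nat) : set (NQuot R N) :=
  [set \pi_(NQuot R N) g | g in [set g : Norm R N | AL_form m g]].

Lemma AL_class_unique (m : nat) : (m %| N)%N ->
  forall x y, AL_class m x -> AL_class m y -> x = y.
Proof.
move=> /dvdnP[M NE] _ _ [g ALg <-] [h ALh <-]; apply/eqP; rewrite NQuot_eq.
case: (ALpos ALg) => s0 s2 [a [b [c [d Eg]]]].
case: (ALpos ALh) => _ _ [a' [b' [c' [d' Eh]]]].
set s := Num.sqrt _ in s0 s2 Eg Eh.
rewrite gmulfM gmulfV; apply/Gamma0P.
have NR : (N%:R = M%:R * s ^+ 2 :> R)%R by rewrite s2 NE natrM.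
pose m' : int := m; pose M' : int := M; pose N' : int := N.
exists (m' * d * a' - M' * b * c')%R, (d * b' - b * d')%R.
exists (- c * a' + a * c')%R, (- M' * c * b' + m' * a * d')%R.
rewrite SL2_mulE Eh (SL2_invE Eg) !mul_mx2.
by congr (mx2 _ _ _ _); rewrite ?(rmorphD, rmorphN, rmorphM, rmorphB) /=
   -?pmulrn ?NR -?s2; field.
Qed.

Lemma AL_class_neq0 (m : nat) : (0 < m)%N -> (m %| N)%N -> coprime m (N %/ m) ->
  AL_class m !=set0.
Proof.
move=> m0 mN cop.
have [u [v uv]] : exists u v : int, (u * m%:Z - (N %/ m)%:Z * v = 1)%R.
  have [u [v uv]] := Bezoutz m%:Z (N %/ m)%:Z.
  exists u, (- v)%R.
  by rewrite mulrN opprK (mulrC _ v) uv /gcdz /= (eqP cop).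
have m0R : (0 <= m%:R :> R)%R by [].
have s2 := sqr_sqrtr m0R; set s := Num.sqrt _ in s2.
have s0 : (s != 0)%R.
  by apply: contraTneq m0 => s0; rewrite -(ltr0n R) -s2 s0 expr0n ltxx.
pose A := ((Num.sqrt m%:R)^-1 *:
    mx2 (m%:Z * u)%:~R v%:~R (N%:Z * 1)%:~R (m%:Z * 1)%:~R : 'M[R]_2)%R.
have dA : \det A == 1%R.
  have MR : (N%:R = (N %/ m)%:R * s ^+ 2 :> R)%R by rewrite s2 -natrM divnK.
  have uvR : (u%:~R * s ^+ 2 - (N %/ m)%:R * v%:~R = 1 :> R)%R.
    by rewrite s2 pmulrn -rmorphM pmulrn -rmorphM -rmorphB uv.
  rewrite /A -/s scale_mx2 det_mx2 !rmorphM /= -?pmulrn MR -s2.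
  by apply/eqP; rewrite -[RHS]uvR; field.
have ALA : AL_form m (MkSL2 dA) by exists u, v, 1%R, 1%R.
by exists (\pi_(NQuot R N) (MkNorm (AL_Norm mN ALA))), (MkNorm (AL_Norm mN ALA)).
Qed.

(* The class of the Atkin-Lehner involution w_m. The default value 1 is only
   reached outside m %| N, coprime m (N %/ m), see [w_clP]. *)
Definition w_cl (m : nat) : NQuot R N := xget 1 (AL_class m).

Lemma w_clP (m : nat) : (0 < m)%N -> (m %| N)%N -> coprime m (N %/ m) ->
  AL_class m = [set w_cl m].
Proof.
move=> m0 mN cop; have [x Ax] := AL_class_neq0 m0 mN cop.
have Aw : AL_class m (w_cl m) by exact: (xgetPex _ (ex_intro _ x Ax)).
by apply/seteqP; split=> [y Ay|_ ->//]; apply: AL_class_unique Ay Aw.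
Qed.

Fact Sshift_det (v : nat) : \det (mx2 1 v%:R^-1 0 1 : 'M[R]_2)%R == 1%R.
Proof. by rewrite det_mx2 mulr0 subr0 mulr1. Qed.

Definition Sshift (v : nat) : SL2 R := MkSL2 (Sshift_det v).

Lemma dvd24_unit (v : nat) (a d : int) : (v %| 24)%N ->
  (v %| a * d - 1)%Z -> (v %| a - d)%Z.
Proof.
move=> v24; have v0 : (0 < v)%N by apply: dvdn_gt0 v24.
have key : all (fun v => all (fun r => all (fun s =>
    (r * s %% v == 1 %% v)%N ==> (r == s)) (iota 0 v)) (iota 0 v)) (divisors 24).
  by vm_compute.
have nat_mod (x : int) : exists2 r : nat, (r < v)%N & (x %% v = r)%Z.
  have := modz_ge0 x (_ : v%:Z != 0%R); rewrite -lt0n => /(_ v0).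
  have := ltz_pmod x (_ : (0 < v%:Z)%R) => /(_ v0).
  by case: (x %% v)%Z => // r rv _; exists r.
have [r rv ar] := nat_mod a; have [s sv ds] := nat_mod d.
rewrite -!eqz_mod_dvd => /eqP ad1; apply/eqP.
have rs1' : (r * s %% v = 1 %% v)%N.
  apply: (can_inj absz_nat); rewrite -!modz_nat PoszM -ar -ds.
  by rewrite modzMml modzMmr.
move: key => /allP/(_ v); rewrite -dvdn_divisors // => /(_ v24).
move=> /allP/(_ r); rewrite mem_iota rv => /(_ isT)/allP/(_ s).
by rewrite mem_iota sv rs1' eqxx => /(_ isT)/eqP rs; rewrite ar ds rs.
Qed.

Fact Sshift_conj (v : nat) (e : int) (g h : SL2 R) : (v %| 24)%N ->
  (v ^ 2 %| N)%N -> (g : 'M_2) = (mx2 1 (e%:~R / v%:R) 0 1)%R ->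
  h \in Gamma0 N -> g * h * g^-1 \in Gamma0 N.
Proof.
move=> v24 /dvdnP[M NE] Eg /Gamma0P[a [b [c [d Eh]]]].
have vad : (v %| a - d)%Z.
  apply: dvd24_unit v24 _; have := SL2_det h; rewrite Eh det_mx2.
  rewrite -!rmorphM -rmorphB -[1%R]/(1%:~R)%R eqr_int => /eqP <-.
  have -> : (a * d - (a * d - b * (N%:Z * c)) = b * c * M * v * v :> int)%R.
    by rewrite NE !PoszM; ring.
  by rewrite dvdz_mull.
have /dvdzP[k adk] := vad.
have v0 : (v%:R != 0 :> R)%R.
  by rewrite pnatr_eq0; apply: contraTneq v24 => ->.
apply/Gamma0P.
pose M' : int := M; pose N' : int := N; pose v' : int := v.
exists (a + e * M' * v' * c)%R, (b - e * k - e * e * M' * c)%R, c.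
exists (d - e * M' * v' * c)%R.
have NR : (N%:R = M%:R * v%:R ^+ 2 :> R)%R by rewrite NE natrM natrX.
have aE : (a%:~R = k%:~R * v%:R + d%:~R :> R)%R.
  by rewrite -[a](subrK d) adk rmorphD rmorphM /= -pmulrn.
rewrite !SL2_mulE Eh (SL2_invE Eg) Eg !mul_mx2.
by congr (mx2 _ _ _ _); rewrite ?(rmorphD, rmorphN, rmorphM, rmorphB) /=
   -?pmulrn ?NR ?aE; field.
Qed.

Lemma Sshift_Norm (v : nat) : (v %| 24)%N -> (v ^ 2 %| N)%N ->
  Sshift v \in NormGamma0 N.
Proof.
move=> v24 vN; apply/NormGamma0P => h; apply/idP/idP; last first.
  by apply: (@Sshift_conj v 1) => //=; rewrite mul1r.
have EV : ((Sshift v)^-1 : 'M_2) = (mx2 1 ((-1)%:~R / v%:R) 0 1)%R.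
  by rewrite (SL2_invE (erefl (Sshift v : 'M_2))) oppr0 mulN1r.
move=> /(Sshift_conj v24 vN EV).
by rewrite invgK !mulgA mulVg mul1g mulgVK.
Qed.

(* The class of S_v. The default value 1 is only reached when Sshift v is not
   in the normalizer, see [Sshift_Norm]. *)
Definition S_cl (v : nat) : NQuot R N :=
  \pi_(NQuot R N) (insubd (1 : Norm R N) (Sshift v)).

Lemma S_clP (v : nat) (g : Norm R N) : val g = Sshift v -> S_cl v = \pi_(NQuot R N) g.
Proof. by rewrite /S_cl => <-; rewrite valKd. Qed.

End AtkinLehner.

Arguments w_cl R N m : clear implicits.
Arguments S_cl R N v : clear implicits.

Section Presentations.
Local Open Scope group_scope.

Definition is_subgroup (T : groupType) (H : set T) : Prop :=
  H 1 /\ forall x y, H x -> H y -> H (x / y).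

Definition gen (T : groupType) (A : set T) : set T := smallest (@is_subgroup T) A.

(* Group words in generators indexed by [I]. *)
Inductive gword (I : Type) : Type :=
  | Gen of I
  | WOne
  | WMul of gword I & gword I
  | WInv of gword I.

HB.instance Definition _ (I : Type) := hasMul.Build (gword I) (@WMul I).
HB.instance Definition _ (I : Type) := hasOne.Build (gword I) (@WOne I).
HB.instance Definition _ (I : Type) := hasInv.Build (gword I) (@WInv I).

Fixpoint geval (T : groupType) (I : Type) (x : I -> T) (t : gword I) : T :=
  match t with
  | Gen i => x i
  | WOne => 1
  | WMul t u => geval x t * geval x u
  | WInv t => (geval x t)^-1
  end.

(* [conseq rels t u]: the equation t = u follows from the equations in [rels]
   and the group axioms, i.e. t and u are equal in <I | rels>. *)
Inductive conseq (I : Type) (rels : set (gword I * gword I)) :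
    gword I -> gword I -> Prop :=
  | conseq_rel t u : rels (t, u) -> conseq rels t u
  | conseq_refl t : conseq rels t t
  | conseq_sym t u : conseq rels t u -> conseq rels u t
  | conseq_trans t u v : conseq rels t u -> conseq rels u v -> conseq rels t v
  | conseq_mul t t' u u' :
      conseq rels t t' -> conseq rels u u' -> conseq rels (t * u) (t' * u')
  | conseq_inv t t' : conseq rels t t' -> conseq rels t^-1 t'^-1
  | conseq_mulA t u v : conseq rels (t * (u * v)) (t * u * v)
  | conseq_mul1 t : conseq rels (1 * t) t
  | conseq_mulV t : conseq rels (t^-1 * t) 1.

(* The canonical map from <I | rels> to the subgroup generated by the x_i is
   well defined and injective, so that the subgroup is presented by [rels]. *)
Definition presented (T : groupType) (I : Type) (x : I -> T)
    (rels : set (gword I * gword I)) : Prop :=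
  forall t u, geval x t = geval x u <-> conseq rels t u.

Definition presented2 (T : groupType) (x y : T)
    (rels : gword bool -> gword bool -> set (gword bool * gword bool)) : Prop :=
  presented (fun b => if b then y else x) (rels (Gen false) (Gen true)).

End Presentations.

(* Main.v *)
(* For a prime p write v_p(N) = 2 mu + nu, where p^mu is the largest power v of p
   with v | 24 and v^2 | N.

   Gamma_0(N) is the intersection of its p-localizations [loc p 0 (v_p N)], and
   w_{q^{v_q(N)}} and S_{q^k} belong to the localization at every p <> q. Hence the
   quotient is the product of the groups G_p = <w_{p^{v_p(N)}}, S_{p^mu}> once every
   g in the normalizer has been moved into the localization at p by some element
   of G_p.

   Conjugating T = [[1,1],[0,1]], [[1,0],[N,1]] and elements of Gamma_0(N) with
   well-chosen diagonal by g = [[a,b],[c,d]] shows that a^2, ac, c^2/N, N b^2, d^2,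
   24ab, 24bc and 24cd/N are integers. So g is a multiple of a primitive integer
   matrix, and the valuations of its entries force g or w^-1 g into [loc p mu nu],
   the conjugate by diag(p^mu, 1) of the localization of Gamma_0(p^nu); there a
   power of S clears the upper right entry modulo p^mu, and a power of w S w the
   lower left one.

   For the relations and the orders, reduce that conjugate modulo p^mu: an element
   of G_p lying in it is trivial in the quotient iff its two off-diagonal entries
   vanish modulo p^mu, so that everything becomes a finite computation. *)
From HB Require Import structures.
Require Import Defs.
From mathcomp Require Import all_boot all_order all_algebra.
From mathcomp Require Import boolp classical_sets cardinality reals.
From mathcomp Require Import ring zify.

Set Implicit Arguments.
Unset Strict Implicit.
Unset Printing Implicit Defensive.

Import Order.TTheory GRing.Theory Num.Theory.

(** * Presentations and normal forms *)

(** The constant 24 is the largest modulus whose units all have square 1. This gives the multipliers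
    24 in the integrality conditions, and for u = p^mu dividing 24 it makes every diagonal matrix of
    SL_2(Z/u) scalar. Hence for v_p(N) = 2 mu the group G_p is SL_2(Z/u) modulo scalars, which
    explains the orders 6, 12, 24 and 96. For nu > 0 the class w leaves [loc p mu nu] and has no
    reduction modulo u; only words with evenly many w do. They are generated by s and w s w, which
    commute exactly when u divides p^nu. In that case G_p has order 2 u^2, for instance 18. A
    presentation is a claim about formal derivations, so computing in the quotient cannot prove it.
    Normal forms are therefore derived in an arbitrary group satisfying the relations and then
    specialized to the group defined by them; the computation in the quotient only has to tell the
    normal forms apart. For u = 8 and nu = 0 no such derivation is made: the order is found by
    exhausting the quotient. *)

Section UniversalGroup.
Local Open Scope group_scope.
Local Open Scope quotient_scope.
Variables (I : Type) (rels : set (gword I * gword I)).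

(** Quotient types need decidable equality and choice, which an arbitrary [I] does not provide; this
    alias carries the classical instances. *)
Definition word := gword I.
HB.instance Definition _ := gen_eqMixin word.
HB.instance Definition _ := gen_choiceMixin word.

Definition conseqb : rel word := fun t u => `[< conseq rels t u >].

Fact conseqb_refl : reflexive conseqb.
Proof. by move=> t; apply/asboolP/conseq_refl. Qed.
Fact conseqb_sym : symmetric conseqb.
Proof. by move=> t u; apply/asboolP/asboolP => /conseq_sym. Qed.
Fact conseqb_trans : transitive conseqb.
Proof.
by move=> u t v /asboolP tu /asboolP uv; apply/asboolP/(conseq_trans tu uv).
Qed.

Canonical conseqb_equiv := EquivRel conseqb conseqb_refl conseqb_sym conseqb_trans.

Definition fpgroup : Type := {eq_quot conseqb_equiv}.
HB.instance Definition _ := Choice.on fpgroup.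
HB.instance Definition _ := EqQuotient.on fpgroup.

Definition fpcls (t : gword I) : fpgroup := \pi_fpgroup (t : word).

Lemma fpclsP (t u : gword I) : fpcls t = fpcls u <-> conseq rels t u.
Proof.
split=> [/eqP|tu]; first by rewrite eqmodE => /asboolP.
by apply/eqP; rewrite eqmodE; apply/asboolP.
Qed.

Lemma fpcls_repr (t : gword I) : conseq rels (repr (fpcls t)) t.
Proof. by apply/fpclsP; rewrite /fpcls reprK. Qed.

Definition fpone : fpgroup := fpcls 1.
Definition fpmul (x y : fpgroup) : fpgroup := fpcls ((repr x : gword I) * repr y).
Definition fpinv (x : fpgroup) : fpgroup := fpcls (repr x : gword I)^-1.

Fact fpmulE t u : fpmul (fpcls t) (fpcls u) = fpcls (t * u).
Proof. by apply/fpclsP/conseq_mul; apply: fpcls_repr. Qed.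
Fact fpinvE t : fpinv (fpcls t) = fpcls t^-1.
Proof. by apply/fpclsP/conseq_inv; apply: fpcls_repr. Qed.
Fact fpclsW (P : fpgroup -> Prop) : (forall t, P (fpcls t)) -> forall x, P x.
Proof. by move=> Pt x; rewrite -[x]reprK; exact: Pt. Qed.

Fact fpmulA : associative fpmul.
Proof.
elim/fpclsW=> x; elim/fpclsW=> y; elim/fpclsW=> z.
by rewrite !fpmulE; apply/fpclsP/conseq_mulA.
Qed.
Fact fpmul1 : left_id fpone fpmul.
Proof. by elim/fpclsW=> x; rewrite fpmulE; apply/fpclsP/conseq_mul1. Qed.
Fact fpmulV : left_inverse fpone fpinv fpmul.
Proof. by elim/fpclsW=> x; rewrite fpinvE fpmulE; apply/fpclsP/conseq_mulV. Qed.
(** [conseq] contains only the left unit and left inverse laws. The right ones follow by inserting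
    (x^-1)^-1 x^-1 = 1 in front of x x^-1. *)
Fact fpmulrV : right_inverse fpone fpinv fpmul.
Proof.
move=> x; have yxy : fpmul (fpinv x) (fpmul x (fpinv x)) = fpinv x.
  by rewrite fpmulA fpmulV fpmul1.
by rewrite -[LHS]fpmul1 -[in LHS](fpmulV (fpinv x)) -fpmulA yxy fpmulV.
Qed.
Fact fpmulr1 : right_id fpone fpmul.
Proof. by move=> x; rewrite -(fpmulV x) fpmulA fpmulrV fpmul1. Qed.

HB.instance Definition _ :=
  isGroup.Build fpgroup fpmulA fpmul1 fpmulr1 fpmulV fpmulrV.

Lemma geval_fpcls t : geval (fun i => fpcls (Gen i)) t = fpcls t.
Proof.
elim: t => //= [t -> u ->|t ->]; first exact: fpmulE.
exact: fpinvE.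
Qed.

End UniversalGroup.

Section NormalForms.
Local Open Scope group_scope.
Local Open Scope classical_set_scope.

Definition satisfies (T : groupType) (I : Type) (x : I -> T)
    (rels : set (gword I * gword I)) : Prop :=
  forall t u, rels (t, u) -> geval x t = geval x u.

Lemma conseq_geval (T : groupType) (I : Type) (x : I -> T) rels t u :
  satisfies x rels -> conseq rels t u -> geval x t = geval x u.
Proof.
move=> xr; elim=> //= {t u}.
- by move=> t u v _ -> _ ->.
- by move=> t t' u u' _ -> _ ->.
- by move=> t t' _ ->.
- by move=> t u v; rewrite mulgA.
- by move=> t; rewrite mul1g.
- by move=> t; rewrite mulVg.
Qed.

Lemma geval_subgroup (T : groupType) (I : Type) (x : I -> T) :
  is_subgroup (range (geval x)).
Proof.
by split=> [|_ _ [t _ <-] [u _ <-]]; [exists 1|exists (t / u)].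
Qed.

Lemma is_subgroupM (T : groupType) (H : set T) x y :
  is_subgroup H -> H x -> H y -> H (x * y).
Proof.
move=> [H1 HF] Hx Hy; have := HF _ _ H1 Hy; rewrite div1g => HVy.
by have := HF _ _ Hx HVy; rewrite invgK.
Qed.

Lemma is_subgroupV (T : groupType) (H : set T) x : is_subgroup H -> H x -> H x^-1.
Proof. by move=> [H1 HF] Hx; rewrite -div1g; exact: HF. Qed.

Lemma is_subgroupX (T : groupType) (H : set T) x n :
  is_subgroup H -> H x -> H (x ^+ n).
Proof.
move=> sH Hx; elim: n => [|n IH]; first by case: sH.
by rewrite expgS; apply: is_subgroupM.
Qed.

Lemma gen_subgroup (T : groupType) (A : set T) : is_subgroup (gen A).
Proof.
split=> [|x y Ax Ay]; first by move=> H [[H1 _] _].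
by move=> H sAH; have [[_ HF] _] := sAH; apply: HF; [exact: Ax|exact: Ay].
Qed.

Lemma gen_sub (T : groupType) (A H : set T) :
  is_subgroup H -> A `<=` H -> gen A `<=` H.
Proof. by move=> sH AH x; apply. Qed.

Lemma sub_gen (T : groupType) (A : set T) : A `<=` gen A.
Proof. by move=> x Ax H [_]; apply. Qed.

Lemma gen_range (T : groupType) (I : Type) (x : I -> T) :
  gen (range x) = range (geval x).
Proof.
apply/seteqP; split.
  by apply: gen_sub (geval_subgroup x) _ => _ [i _ <-]; exists (Gen i).
have sg := gen_subgroup (range x).
move=> _ [t _ <-]; elim: t => /= [i||t tr u ur|t tr].
- by apply: (@sub_gen _ (range x)); exists i.
- by case: sg.
- exact: (is_subgroupM sg).
- exact: (is_subgroupV sg).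
Qed.

Lemma range_bool (T : Type) (x y : T) :
  range (fun b : bool => if b then y else x) = [set x; y].
Proof.
apply/seteqP; split=> [_ [[] _ <-]|z [->|->]]; [by right|by left|..].
  by exists false.
by exists true.
Qed.

(** [A] need not be a subgroup, so the induction concerns translates: right multiplication by a word
    and by its inverse both preserve [A]. Torsion turns the inverse of a generator into a positive
    power. *)
Lemma geval_mul_closed (T : groupType) (I : Type) (x : I -> T) (A : set T) :
  A 1 -> (forall i, exists k, x i ^+ k.+1 = 1) ->
  (forall a i, A a -> A (a * x i)) -> forall t, A (geval x t).
Proof.
move=> A1 tor Ax t.
have AxV a i : A a -> A (a * (x i)^-1).
  move=> Aa; have [k xk] := tor i.
  have -> : (x i)^-1 = x i ^+ k by apply: mulg1_eq; rewrite -expgS.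
  by elim: k {xk} => [|k IH]; rewrite ?mulg1 // expgSr mulgA; apply: Ax.
suff H a : A a -> A (a * geval x t) /\ A (a * (geval x t)^-1).
  by have [] := H _ A1; rewrite mul1g.
elim: t a => /= [i||t IHt u IHu|t IHt] a Aa.
- by split; [exact: Ax|exact: AxV].
- by rewrite invg1 mulg1.
- rewrite invgM !mulgA; split; first by apply: (proj1 (IHu _ _)); apply: (proj1 (IHt _ _)).
  by apply: (proj2 (IHt _ _)); apply: (proj2 (IHu _ _)).
- by rewrite invgK; have [] := IHt _ Aa.
Qed.

Definition word_gword (I : Type) (l : seq I) : gword I :=
  foldr (fun i t => Gen i * t) 1 l.

Lemma geval_word (T : groupType) (I : Type) (x : I -> T) l :
  geval x (word_gword l) = \prod_(i <- l) x i.
Proof. by elim: l => [|i l IH]; rewrite ?big_nil //= big_cons IH. Qed.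

(** Specialized to the group defined by [rels], the second hypothesis becomes a formal derivation
    from every word to one in [L]. Two words with the same value in [T] then have the same normal
    form by injectivity, hence are derivable from each other. *)
Lemma presented_normal_forms (T : groupType) (I : eqType) (x : I -> T) rels
    (L : seq (seq I)) :
  satisfies x rels ->
  (forall (U : groupType) (y : I -> U), satisfies y rels ->
     forall t, exists2 l, l \in L & geval y t = \prod_(i <- l) y i) ->
  {in L &, injective (fun l => \prod_(i <- l) x i)} ->
  presented x rels.
Proof.
move=> xr nf inj t u; split; last exact: conseq_geval.
have yr : satisfies (fun i => fpcls rels (Gen i)) rels.
  by move=> t' u' r; rewrite !geval_fpcls; apply/fpclsP/conseq_rel.
have nfc t' : exists2 l, l \in L & conseq rels t' (word_gword l).
  have [l Ll] := nf _ _ yr t'; rewrite -geval_word !geval_fpcls => /fpclsP tl.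
  by exists l.
have [l Ll tl] := nfc t; have [l' Ll' ul'] := nfc u.
rewrite (conseq_geval xr tl) (conseq_geval xr ul') !geval_word.
move=> /(inj _ _ Ll Ll') ll'.
by rewrite ll' in tl; apply: conseq_trans tl (conseq_sym ul').
Qed.

Lemma card_gen_normal_forms (T : groupType) (I : eqType) (x : I -> T)
    (L : seq (seq I)) :
  (forall t, exists2 l, l \in L & geval x t = \prod_(i <- l) x i) ->
  {in L &, injective (fun l => \prod_(i <- l) x i)} -> uniq L ->
  (gen (range x) #= `I_(size L))%card.
Proof.
move=> nf inj uL; rewrite gen_range.
have -> : range (geval x) =
    [set \prod_(i <- nth [::] L k) x i | k in `I_(size L)].
  apply/seteqP; split=> [_ [t _ <-]|_ [k kL <-]].
    have [l Ll ->] := nf t; exists (index l L); rewrite ?nth_index //=.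
    by rewrite index_mem.
  by exists (word_gword (nth [::] L k)); rewrite ?geval_word.
apply: inj_card_eq => i j /set_mem iL /set_mem jL.
by move/(inj _ _ (mem_nth _ iL) (mem_nth _ jL))/eqP; rewrite nth_uniq // => /eqP.
Qed.

End NormalForms.

(** * Rewriting words in an involution w and an element s with s^u = 1 *)

Section TwoGenerators.
Local Open Scope group_scope.
Local Open Scope classical_set_scope.
Variables (T : groupType) (y : bool -> T) (u : nat).
Hypothesis u_gt0 : (0 < u)%N.
Let w := y false.
Let s := y true.
Hypothesis w2 : w ^+ 2 = 1.
Hypothesis su : s ^+ u = 1.

(** The lengths of these lists predict the orders: u + u^2 is 6 or 12 for u = 2, 3; the u words of
    [words_wssw] raise it to 24 for u = 4; [words1] and [words2] together have 2 u^2 words. *)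
Definition words0 : seq (seq bool) := [seq nseq i true | i <- iota 0 u].
Definition words1 : seq (seq bool) :=
  [seq nseq i true ++ false :: nseq j true | i <- iota 0 u, j <- iota 0 u].
Definition words_wssw : seq (seq bool) :=
  [seq nseq i true ++ [:: false; true; true; false] | i <- iota 0 u].
Definition words2 : seq (seq bool) :=
  [seq nseq i true ++ false :: rcons (nseq j true) false
    | i <- iota 0 u, j <- iota 0 u].

Let ww : w * w = 1. Proof. by rewrite -expg2. Qed.
Let wwK x : x * w * w = x. Proof. by rewrite -mulgA ww mulg1. Qed.
Let wV : w^-1 = w. Proof. exact: mulg1_eq ww. Qed.
Let s_mod i : s ^+ i = s ^+ (i %% u).
Proof.
by rewrite {1}(divn_eq i u) expgnDr mulnC expgnA su expg1n mul1g.
Qed.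
Let sV : s^-1 = s ^+ u.-1.
Proof. by apply: mulg1_eq; rewrite -expgS prednK. Qed.

Let mod_iota i : (i %% u)%N \in iota 0 u.
Proof. by rewrite mem_iota ltn_mod. Qed.

Lemma words0P i : exists2 l, l \in words0 & s ^+ i = \prod_(b <- l) y b.
Proof.
exists (nseq (i %% u) true); first by apply: map_f.
by rewrite big_nseq iter_mulg_1 -s_mod.
Qed.

Lemma words1P i j :
  exists2 l, l \in words1 & s ^+ i * w * s ^+ j = \prod_(b <- l) y b.
Proof.
exists (nseq (i %% u) true ++ false :: nseq (j %% u) true).
  exact: allpairs_f.
by rewrite big_cat big_cons /= !big_nseq !iter_mulg_1 -!s_mod mulgA.
Qed.

Lemma words_wsswP i :
  exists2 l, l \in words_wssw & s ^+ i * w * s ^+ 2 * w = \prod_(b <- l) y b.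
Proof.
exists (nseq (i %% u) true ++ [:: false; true; true; false]).
  by apply/mapP; exists (i %% u)%N.
rewrite big_cat !big_cons big_nil /= !big_nseq !iter_mulg_1 -!s_mod mulg1.
by rewrite expg2 !mulgA.
Qed.

Lemma words2P i j :
  exists2 l, l \in words2 & s ^+ i * w * s ^+ j * w = \prod_(b <- l) y b.
Proof.
exists (nseq (i %% u) true ++ false :: rcons (nseq (j %% u) true) false).
  by apply: (allpairs_f (fun i j => nseq i true ++ false :: rcons (nseq j true) false)).
rewrite -cats1 big_cat big_cons /= big_cat big_cons big_nil /=.
by rewrite !big_nseq !iter_mulg_1 -!s_mod mulg1 !mulgA.
Qed.

Let torsion b : exists k, y b ^+ k.+1 = 1.
Proof. by case: b; [exists u.-1; rewrite prednK|exists 1%N]. Qed.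

Let in_words (P : set T) (L : seq (seq bool)) :
  P 1 -> (forall x, P x -> P (x * w)) -> (forall x, P x -> P (x * s)) ->
  (forall x, P x -> exists2 l, l \in L & x = \prod_(b <- l) y b) ->
  forall t, exists2 l, l \in L & geval y t = \prod_(b <- l) y b.
Proof.
move=> P1 Pw Ps PL t; apply: PL; apply: geval_mul_closed P1 torsion _ t.
by move=> x [] Px; [exact: Ps|exact: Pw].
Qed.

(** Conjugation by w exchanges s and w s w. When these commute they generate a normal abelian
    subgroup, so every element is s^i (w s w)^j times a power of w. *)
Lemma words_commute : commute s (w * s * w) ->
  forall t, exists2 l, l \in words1 ++ words2 & geval y t = \prod_(b <- l) y b.
Proof.
move=> c; pose P : set T := [set x | (exists i j, x = s ^+ i * w * s ^+ j) \/
  exists i j, x = s ^+ i * w * s ^+ j * w].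
have wsw j : w * s ^+ j * w = (w * s * w) ^+ j.
  elim: j => [|j IH]; first by rewrite mulg1 ww.
  by rewrite !expgSr -IH !mulgA wwK.
apply: (@in_words P).
- by right; exists 0%N, 0%N; rewrite !mulg1 mul1g ww.
- move=> x [] [i [j ->]]; first by right; exists i, j.
  by left; exists i, j; rewrite wwK.
- move=> x [] [i [j ->]]; first by left; exists i, j.+1; rewrite -mulgA -expgSr.
  right; exists i.+1, j.
  have sj : w * s ^+ j * w * s = s * (w * s ^+ j * w).
    by rewrite wsw; apply/esym/commuteX.
  have -> : s ^+ i * w * s ^+ j * w * s = s ^+ i * (w * s ^+ j * w * s).
    by rewrite !mulgA.
  by rewrite sj expgSr !mulgA.
- move=> x [] [i [j ->]].
    by have [l lL ->] := words1P i j; exists l; rewrite // mem_cat lL.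
  by have [l lL ->] := words2P i j; exists l; rewrite // mem_cat lL orbT.
Qed.

Hypothesis ws3 : (w * s) ^+ 3 = 1.

(** Read from left to right this removes one w; together with its inverse [wsVw] it drives both
    reductions below. *)
Let wsw : w * s * w = s^-1 * w * s^-1.
Proof.
apply: (mulIg s); apply: (mulgI (w * s)); rewrite mulgVK !mulgA mulgK ww -ws3.
by rewrite expgS expg2 !mulgA.
Qed.
Let wsVw : w * s^-1 * w = s * w * s.
Proof. by apply: invg_inj; rewrite !invgM invgK wV mulgA wsw mulgA. Qed.

Let wsVw' : w * s ^+ u.-1 * w = s * w * s.
Proof. by rewrite -sV. Qed.

(** For such u every exponent is 0, 1 or -1 modulo u, so a subword w s^j w can always be shortened
    to one with at most one w. *)
Lemma words_ws3_le3 : (1 < u <= 3)%N ->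
  forall t, exists2 l, l \in words0 ++ words1 & geval y t = \prod_(b <- l) y b.
Proof.
move=> u3; pose P : set T := [set x | (exists i, x = s ^+ i) \/
  exists i j, x = s ^+ i * w * s ^+ j].
apply: (@in_words P).
- by left; exists 0%N.
- move=> x [] [i]; first by move=> ->; right; exists i, 0%N; rewrite mulg1.
  move=> [j ->]; rewrite s_mod [s ^+ j]s_mod.
  have := ltn_pmod j u_gt0; case: (j %% u)%N => [|[|[|k]]] ju; last by lia.
  + by left; exists (i %% u)%N; rewrite mulg1 wwK.
  + right; exists (i %% u + u.-1)%N, u.-1.
    by rewrite expg1 expgnDr -sV -!mulgA; congr (_ * _); rewrite !mulgA wsw.
  + right; exists (i %% u).+1, 1%N; have -> : 2%N = u.-1 by lia.
    by rewrite expg1 expgSr -!mulgA; congr (_ * _); rewrite !mulgA wsVw'.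
- move=> x [] [i]; first by move=> ->; left; exists i.+1; rewrite expgSr.
  by move=> [j ->]; right; exists i, j.+1; rewrite expgSr !mulgA.
- move=> x [] [i].
    move=> ->; have [l lL ->] := words0P i.
    by exists l; rewrite // mem_cat lL.
  move=> [j ->]; have [l lL ->] := words1P i j.
  by exists l; rewrite // mem_cat lL orbT.
Qed.

Lemma words_ws3_4 : u = 4%N -> forall t,
  exists2 l, l \in words0 ++ words1 ++ words_wssw & geval y t = \prod_(b <- l) y b.
Proof.
move=> u4; pose P : set T := [set x | [\/ exists i, x = s ^+ i,
  exists i j, x = s ^+ i * w * s ^+ j | exists i, x = s ^+ i * w * s ^+ 2 * w]].
(* For u = 4 only w s^2 w resists shortening. Since s^-2 = s^2, a factor s can be moved across it to
   the left, where it becomes s^-1. *)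
have wssws : w * s ^+ 2 * w * s = s^-1 * w * s ^+ 2 * w.
  have -> : w * s ^+ 2 * w * s = w * s * (s * w * s) by rewrite expg2 !mulgA.
  rewrite -wsVw !mulgA wsw -2!(mulgA (s^-1 * w)); congr (_ * _ * _).
  by rewrite sV u4 -expgnDr s_mod u4.
rewrite !expg2 !mulgA in wssws.
apply: (@in_words P).
- by constructor 1; exists 0%N.
- move=> x [] [i]; first by move=> ->; constructor 2; exists i, 0%N; rewrite mulg1.
    move=> [j ->]; rewrite s_mod [s ^+ j]s_mod.
    have := ltn_pmod j u_gt0; case: (j %% u)%N => [|[|[|[|k]]]] ju; last by lia.
    + by constructor 1; exists (i %% u)%N; rewrite mulg1 wwK.
    + constructor 2; exists (i %% u + u.-1)%N, u.-1.
      by rewrite expg1 expgnDr -sV -!mulgA; congr (_ * _); rewrite !mulgA wsw.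
    + by constructor 3; exists (i %% u)%N.
    + constructor 2; exists (i %% u).+1, 1%N; have -> : 3%N = u.-1 by lia.
      by rewrite expg1 expgSr -!mulgA; congr (_ * _); rewrite !mulgA wsVw'.
  by move=> ->; constructor 2; exists i, 2%N; rewrite wwK.
- move=> x [] [i].
  + by move=> ->; constructor 1; exists i.+1; rewrite expgSr.
  + by move=> [j ->]; constructor 2; exists i, j.+1; rewrite expgSr !mulgA.
  + move=> ->; constructor 3; exists (i + u.-1)%N.
    by rewrite expgnDr -sV -!mulgA; congr (_ * _); rewrite !mulgA wssws.
- move=> x [] [i].
  + move=> ->; have [l lL ->] := words0P i.
    by exists l; rewrite // mem_cat lL.
  + move=> [j ->]; have [l lL ->] := words1P i j.
    by exists l; rewrite // !mem_cat lL orbT.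
  + move=> ->; have [l lL ->] := words_wsswP i.
    by exists l; rewrite // !mem_cat lL !orbT.
Qed.

End TwoGenerators.

(** * Localizations of Gamma_0(N) *)

Section Localization.
Local Open Scope ring_scope.
Variable R : realType.
Implicit Types (p mu nu N : nat) (g h : SL2 R).

Lemma mx2_inj (T : Type) (a b c d a' b' c' d' : T) :
  mx2 a b c d = mx2 a' b' c' d' -> [/\ a = a', b = b', c = c' & d = d'].
Proof.
move=> /matrixP E; have := E 0 0; have := E 0 1; have := E 1 0; have := E 1 1.
by rewrite !mxE /=; split.
Qed.

(** The real scale absorbs the square roots of Atkin-Lehner matrices and all denominators prime to
    p; a determinant prime to p replaces invertibility over the integers localized at p. *)
Definition loc p mu nu g : Prop := exists (s : R) (a b c d : int),
  ~~ (p %| a * d - (p ^ nu)%:Z * b * c)%Z /\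
  s *: (g : 'M_2) = mx2 a%:~R (b%:~R / (p ^ mu)%:R)
                        ((p ^ (mu + nu))%:Z * c)%:~R d%:~R.

Section Prime.
Variable p : nat.
Hypothesis p_pr : prime p.

Lemma prime_expR_neq0 k : (p ^ k)%:R != 0 :> R.
Proof. by rewrite pnatr_eq0 -lt0n expn_gt0 prime_gt0. Qed.

Lemma Euclid_dvdzM (a b : int) : (p %| a * b)%Z = (p %| a)%Z || (p %| b)%Z.
Proof. by rewrite !dvdzE abszM Euclid_dvdM. Qed.

Lemma scaled_loc_mul mu nu g h (s s' : R) (a b c d a' b' c' d' : int) :
  s *: (g : 'M_2) = mx2 a%:~R (b%:~R / (p ^ mu)%:R)
                        ((p ^ (mu + nu))%:Z * c)%:~R d%:~R ->
  s' *: (h : 'M_2) = mx2 a'%:~R (b'%:~R / (p ^ mu)%:R)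
                        ((p ^ (mu + nu))%:Z * c')%:~R d'%:~R ->
  (s * s') *: ((g * h)%g : 'M_2) =
    mx2 (a * a' + (p ^ nu)%:Z * b * c')%:~R ((a * b' + b * d')%:~R / (p ^ mu)%:R)
        ((p ^ (mu + nu))%:Z * (c * a' + d * c'))%:~R
        ((p ^ nu)%:Z * c * b' + d * d')%:~R.
Proof.
move=> E E'; have p0 := prime_expR_neq0 mu.
rewrite SL2_mulE -scalerA scalemxAr scalemxAl E E' mul_mx2 expnD.
by congr (mx2 _ _ _ _); rewrite !(rmorphD, rmorphM) /= -?pmulrn; field.
Qed.

Lemma loc_mul mu nu g h : loc p mu nu g -> loc p mu nu h -> loc p mu nu (g * h)%g.
Proof.
move=> [s [a [b [c [d [D E]]]]]] [s' [a' [b' [c' [d' [D' E']]]]]].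
exists (s * s'), (a * a' + (p ^ nu)%:Z * b * c'), (a * b' + b * d').
exists (c * a' + d * c'), ((p ^ nu)%:Z * c * b' + d * d'); split.
  have -> : (a * a' + (p ^ nu)%:Z * b * c') * ((p ^ nu)%:Z * c * b' + d * d')
    - (p ^ nu)%:Z * (a * b' + b * d') * (c * a' + d * c') =
    (a * d - (p ^ nu)%:Z * b * c) * (a' * d' - (p ^ nu)%:Z * b' * c') by ring.
  by rewrite Euclid_dvdzM negb_or D D'.
exact: scaled_loc_mul.
Qed.

Lemma loc_inv mu nu g : loc p mu nu g -> loc p mu nu (g^-1)%g.
Proof.
move=> [s [a [b [c [d [D E]]]]]].
have s0 : s != 0.
  apply: contraNneq D => s0; have := congr1 determinant E.
  rewrite s0 scale0r det0 det_mx2.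
  have -> : a%:~R * d%:~R - b%:~R / (p ^ mu)%:R * ((p ^ (mu + nu))%:Z * c)%:~R =
     (a * d - (p ^ nu)%:Z * b * c)%:~R :> R.
    have p0 := prime_expR_neq0 mu.
    by rewrite expnD !(rmorphB, rmorphM) /= -?pmulrn; field.
  by move/eqP; rewrite eq_sym intr_eq0 => /eqP ->; rewrite dvdz0.
exists s, d, (- b), (- c), a; split.
  by have -> : d * a - (p ^ nu)%:Z * - b * - c = a * d - (p ^ nu)%:Z * b * c by ring.
have Eg : (g : 'M_2) = mx2 (s^-1 * a%:~R) (s^-1 * (b%:~R / (p ^ mu)%:R))
    (s^-1 * ((p ^ (mu + nu))%:Z * c)%:~R) (s^-1 * d%:~R).
  by rewrite -scale_mx2 -E scalerA mulVf // scale1r.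
have p0 := prime_expR_neq0 mu.
rewrite (SL2_invE Eg) scale_mx2.
by congr (mx2 _ _ _ _); rewrite ?(rmorphN, rmorphM) /=; field; rewrite ?s0 ?p0.
Qed.

Lemma loc_one mu nu : loc p mu nu 1%g.
Proof.
exists 1, 1, 0, 0, 1; rewrite mulr0 subr0 mulr1 mul0r mulr0 scale1r -scalar_mx2.
by split; rewrite // dvdz1; apply: contraTneq (prime_gt1 p_pr) => /= ->.
Qed.

Lemma loc_widen mu nu g : loc p 0 (2 * mu + nu) g -> loc p mu nu g.
Proof.
move=> [s [a [b [c [d [D E]]]]]].
exists s, a, ((p ^ mu)%:Z * b), ((p ^ mu)%:Z * c), d; split.
  by apply: contra D; rewrite mul2n -addnn !expnD !PoszM; congr (_ %| _)%Z; ring.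
have p0 := prime_expR_neq0 mu.
rewrite E add0n mul2n -addnn !expnD expn0.
by congr (mx2 _ _ _ _); rewrite ?(rmorphM) /=; field.
Qed.

Lemma Gamma0_loc N g : (0 < N)%N -> g \in Gamma0 N -> loc p 0 (logn p N) g.
Proof.
move=> N0 /Gamma0P[a [b [c [d Eg]]]].
have /dvdnP[M NE] := pfactor_dvdnn p N.
have := SL2_det g; rewrite Eg det_mx2.
rewrite -!rmorphM -rmorphB -[1]/(1%:~R) eqr_int => /eqP dg.
exists 1, a, b, (M%:Z * c), d; rewrite scale1r Eg; split.
  have -> : a * d - (p ^ logn p N)%:Z * b * (M%:Z * c) = 1.
    by rewrite -[RHS]dg [X in _ = _ - b * (X%:Z * c)]NE PoszM; ring.
  by rewrite dvdz1; apply: contraTneq (prime_gt1 p_pr) => /= ->.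
rewrite add0n divr1; congr (mx2 _ _ _ _); congr (_%:~R).
by rewrite {1}NE PoszM; ring.
Qed.

End Prime.

Lemma primitive4 (a b c d : int) : ~~ [&& a == 0, b == 0, c == 0 & d == 0] ->
  exists2 e : int, e != 0 & exists a0 b0 c0 d0 x y z t : int,
  [/\ a = e * a0, b = e * b0, c = e * c0, d = e * d0 &
     x * a0 + y * b0 + z * c0 + t * d0 = 1].
Proof.
move=> nz; set e := gcdz (gcdz a b) (gcdz c d).
have e0 : e != 0.
  apply: contra nz; rewrite /e !gcdz_eq0 -!andbA => /and4P[-> -> -> ->] //.
exists e => //.
have [u [v uv]] := Bezoutz a b; have [u' [v' uv']] := Bezoutz c d.
have [k [l kl]] := Bezoutz (gcdz a b) (gcdz c d).
have /dvdzP[a0 a0E] : (e %| a)%Z := dvdz_trans (dvdz_gcdl _ _) (dvdz_gcdl _ _).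
have /dvdzP[b0 b0E] : (e %| b)%Z := dvdz_trans (dvdz_gcdl _ _) (dvdz_gcdr _ _).
have /dvdzP[c0 c0E] : (e %| c)%Z := dvdz_trans (dvdz_gcdr _ _) (dvdz_gcdl _ _).
have /dvdzP[d0 d0E] : (e %| d)%Z := dvdz_trans (dvdz_gcdr _ _) (dvdz_gcdr _ _).
exists a0, b0, c0, d0, (k * u), (k * v), (l * u'), (l * v').
split; rewrite 1?mulrC //; apply: (mulfI e0); rewrite mulr1.
rewrite -[RHS]kl -uv -uv' [in RHS]a0E [in RHS]b0E [in RHS]c0E [in RHS]d0E.
ring.
Qed.

(** Primitivity is kept as an explicit Bezout relation: evaluated on another integral multiple of g,
    it shows that the ratio of the two scales is an integer. *)
Definition prim_form g : Prop := exists (s : R) (a b c d x y z t : int),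
  [/\ s *: (g : 'M_2) = mx2 a%:~R b%:~R c%:~R d%:~R,
      s ^+ 2 = (a * d - b * c)%:~R, s != 0 &
      x * a + y * b + z * c + t * d = 1].

Lemma prim_formP g (s : R) (a b c d : int) : s != 0 ->
  s *: (g : 'M_2) = mx2 a%:~R b%:~R c%:~R d%:~R -> prim_form g.
Proof.
move=> s0 E; have detE : s ^+ 2 = (a * d - b * c)%:~R.
  have := congr1 determinant E; rewrite detZ (eqP (SL2_det g)) mulr1 det_mx2 => ->.
  by rewrite rmorphB !rmorphM.
have nz : ~~ [&& a == 0, b == 0, c == 0 & d == 0].
  apply: contra s0 => /and4P[/eqP a0 /eqP b0 /eqP c0 /eqP d0].
  by move: detE; rewrite a0 b0 mul0r mul0r subrr => /eqP; rewrite expf_eq0.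
have [e e0 [a0 [b0 [c0 [d0 [x [y [z [t [aE bE cE dE B]]]]]]]]]] := primitive4 nz.
have eR : e%:~R != 0 :> R by rewrite intr_eq0.
have s'0 : s / e%:~R != 0 by rewrite mulf_neq0 ?invr_eq0.
exists (s / e%:~R), a0, b0, c0, d0, x, y, z, t; split=> //.
  rewrite mulrC -scalerA E aE bE cE dE scale_mx2.
  by congr (mx2 _ _ _ _); rewrite rmorphM /= mulKf.
by rewrite expr_div_n detE aE bE cE dE !(rmorphB, rmorphM) /=; field.
Qed.

Lemma loc_prim_form p nu g : prime p -> loc p 0 nu g -> prim_form g.
Proof.
move=> p_pr [s [a [b [c [d [D E]]]]]].
apply: (@prim_formP g s a b ((p ^ nu)%:Z * c) d); last by rewrite E add0n divr1.
apply: contraNneq D => s0; have := congr1 determinant E.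
rewrite s0 scale0r det0 det_mx2 add0n divr1 -!rmorphM -rmorphB.
move/eqP; rewrite eq_sym intr_eq0 => /eqP.
have -> : a * d - b * ((p ^ nu)%:Z * c) = a * d - (p ^ nu)%:Z * b * c by ring.
by move->; rewrite dvdz0.
Qed.

Lemma dvdn_logn N m : (0 < N)%N -> (forall p, prime p -> p ^ logn p N %| m)%N ->
  (N %| m)%N.
Proof.
move=> N0 H; case: (posnP m) => [->|m0]; first exact: dvdn0.
apply/dvdn_partP => // p; rewrite mem_primes => /and3P[p_pr _ _].
by rewrite p_part; exact: H.
Qed.

(** All local forms are compared with a single primitive multiple of g. Its determinant is positive
    and prime to every p, hence 1, and its lower left entry is divisible by every p^(v_p(N)). Only a
    scale of 1 or -1 is left. *)
Lemma loc_Gamma0 N g : (0 < N)%N ->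
  (forall p, prime p -> loc p 0 (logn p N) g) -> g \in Gamma0 N.
Proof.
move=> N0 lg; have := loc_prim_form (isT : prime 2) (lg 2 isT).
move=> [s [a [b [c [d [x [y [z [t [E s2 s0 B]]]]]]]]]].
have key p : prime p -> ~~ (p %| a * d - b * c)%Z /\ ((p ^ logn p N)%:Z %| c)%Z.
  move=> p_pr; have [s' [a' [b' [c' [d' [D' E']]]]]] := lg _ p_pr.
  rewrite add0n expn0 divr1 in E'.
  have [ea eb ec ed] : [/\ a'%:~R = s' / s * a%:~R, b'%:~R = s' / s * b%:~R,
     ((p ^ logn p N)%:Z * c')%:~R = s' / s * c%:~R & d'%:~R = s' / s * d%:~R].
    by apply: mx2_inj; rewrite -E' -scale_mx2 -E scalerA divfK.
  (* The Bezout combination of the local entries is the ratio of the scales, which is thus an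
     integer; it divides the local determinant, so p does not divide it. *)
  pose r := x * a' + y * b' + z * ((p ^ logn p N)%:Z * c') + t * d'.
  have rE : s' / s = r%:~R.
    rewrite /r; move: (_ * c') ec => q ec.
    rewrite !(rmorphD, rmorphM) /= ea eb ec ed.
    rewrite -[LHS]mulr1 -[in LHS](_ : 1%:~R = 1 :> R) // -B.
    by rewrite !(rmorphD, rmorphM) /=; ring.
  have [{}ea {}eb {}ec {}ed] : [/\ a' = r * a, b' = r * b,
     (p ^ logn p N)%:Z * c' = r * c & d' = r * d].
    by split; apply: (@intr_inj R); rewrite ?ea ?eb ?ec ?ed rE rmorphM.
  have {}D' : ~~ (p %| r)%Z && ~~ (p %| a * d - b * c)%Z.
    rewrite -negb_or; apply: contra D'.
    rewrite -(Euclid_dvdzM p_pr) ea eb ed => H.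
    have -> : r * a * (r * d) - (p ^ logn p N)%:Z * (r * b) * c' =
      r * (r * (a * d - b * c)).
      by rewrite [_ * c']mulrAC ec; ring.
    by rewrite dvdz_mull.
  have /andP[pr ->] := D'; split=> //.
  have : ((p ^ logn p N)%:Z %| r * c)%Z by rewrite -ec dvdz_mulr.
  rewrite Gauss_dvdzr // coprimezE /= coprimeXl //.
  by rewrite prime_coprime // -dvdzE.
have m1 : a * d - b * c = 1.
  have m0 : 0 < a * d - b * c.
    by rewrite -(ltr0z R) -s2 exprn_even_gt0.
  have : absz (a * d - b * c)%R == 1%N.
    rewrite eqn_leq absz_gt0 lt0r_neq0 // andbT leqNgt.
    by apply/negP => /pdivP[q q_pr qm]; have [/negP[]] := key _ q_pr.
  by move: m0; case: (a * d - b * c) => // k _ /= /eqP ->.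
have /dvdzP[c' cE] : (N %| c)%Z.
  by rewrite dvdzE; apply: dvdn_logn => // p /key[_]; rewrite dvdzE.
have gE : (g : 'M_2) = s *: mx2 a%:~R b%:~R c%:~R d%:~R.
  by rewrite -E scalerA -expr2 s2 m1 scale1r.
have : s = 1 \/ s = -1.
  by move: s2; rewrite m1 => /eqP; rewrite sqrf_eq1 => /orP[] /eqP; [left|right].
case=> sE; apply/Gamma0P.
  by exists a, b, c', d; rewrite gE sE scale1r cE mulrC.
exists (- a), (- b), (- c'), (- d); rewrite gE sE scale_mx2 cE !mulN1r.
by congr (mx2 _ _ _ _); rewrite -rmorphN ?mulrN // mulrC.
Qed.

End Localization.

(** * Integrality in the normalizer *)

Section Normalizer.
Local Open Scope ring_scope.
Variable R : realType.
Implicit Types (N : nat) (g h : SL2 R).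

Lemma Gamma0_int N g (a b c d : R) : (0 < N)%N -> (g : 'M_2) = mx2 a b c d ->
  g \in Gamma0 N -> [/\ a \is a Num.int, b \is a Num.int,
    c / N%:R \is a Num.int & d \is a Num.int].
Proof.
move=> N0 Eg /Gamma0P[a' [b' [c' [d']]]]; rewrite Eg => E.
have [-> -> -> ->] := mx2_inj E.
have NR : N%:R != 0 :> R by rewrite pnatr_eq0 -lt0n.
by rewrite !intr_int rmorphM /= -pmulrn mulrC mulKf // intr_int.
Qed.

Fact unipotent_det (p q r t : int) (N : nat) : p * t - q * (N%:Z * r) = 1 ->
  \det (mx2 p%:~R q%:~R (N%:Z * r)%:~R t%:~R : 'M[R]_2) == 1.
Proof. by move=> E; rewrite det_mx2 -!rmorphM -rmorphB E. Qed.

(** For h = [[p, q], [N r, t]] the three expressions are the upper entries of g h g^-1 and its lower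
    left entry divided by N. *)
Lemma Norm_conj_int N g (a b c d : R) (p q r t : int) : (0 < N)%N ->
  (g : 'M_2) = mx2 a b c d -> g \in NormGamma0 N ->
  p * t - q * (N%:Z * r) = 1 ->
  [/\ p%:~R * (a * d) + r%:~R * (N%:R * (b * d)) - q%:~R * (a * c)
        - t%:~R * (b * c) \is a Num.int,
      (t - p)%:~R * (a * b) - r%:~R * (N%:R * b ^+ 2) + q%:~R * a ^+ 2 \is a Num.int
    & (p - t)%:~R * (c * d / N%:R) + r%:~R * d ^+ 2 - q%:~R * (c ^+ 2 / N%:R)
        \is a Num.int].
Proof.
move=> N0 Eg /NormGamma0P Ng D.
have NR : N%:R != 0 :> R by rewrite pnatr_eq0 -lt0n.
pose h := MkSL2 (unipotent_det D).
have hG : h \in Gamma0 N by apply/Gamma0P; exists p, q, r, t.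
have : (g * h * g^-1)%g \in Gamma0 N by rewrite Ng.
have E : ((g * h * g^-1)%g : 'M_2) = mx2 a b c d *m
    mx2 p%:~R q%:~R (N%:Z * r)%:~R t%:~R *m mx2 d (- b) (- c) a.
  by rewrite !SL2_mulE (SL2_invE Eg) Eg.
rewrite !mul_mx2 in E.
move/(Gamma0_int N0 E) => [e1 e2 e3 _]; split.
- suff -> : p%:~R * (a * d) + r%:~R * (N%:R * (b * d)) - q%:~R * (a * c)
      - t%:~R * (b * c) = (a * p%:~R + b * (N%:Z * r)%:~R) * d +
          (a * q%:~R + b * t%:~R) * - c by [].
  by rewrite rmorphM /= -pmulrn; ring.
- suff -> : (t - p)%:~R * (a * b) - r%:~R * (N%:R * b ^+ 2) + q%:~R * a ^+ 2 =
      (a * p%:~R + b * (N%:Z * r)%:~R) * - b + (a * q%:~R + b * t%:~R) * a by [].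
  by rewrite rmorphM /= -pmulrn rmorphB /=; ring.
- suff -> : (p - t)%:~R * (c * d / N%:R) + r%:~R * d ^+ 2 - q%:~R * (c ^+ 2 / N%:R)
      = ((c * p%:~R + d * (N%:Z * r)%:~R) * d +
         (c * q%:~R + d * t%:~R) * - c) / N%:R by [].
  by rewrite rmorphM /= -pmulrn rmorphB /=; field.
Qed.

(** Choose p congruent to 3 modulo the 2-part e of N and to 2 modulo the odd part M; it is a unit
    modulo N. Then p^2 - 1 is 8 modulo e and 3 modulo M, so 8 lies in the ideal (p^2 - 1, e), 3 lies
    in (p^2 - 1, M), and their product 24 lies in (p^2 - 1, N). *)
Lemma ex_unit_24 N : (0 < N)%N -> exists p q t k l : int,
  p * t - q * N%:Z = 1 /\ N%:Z * k + (p ^+ 2 - 1) * l = 24.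
Proof.
move=> N0; have [M cM NE] := pfactor_coprime (isT : prime 2) N0.
set e := (2 ^ logn 2 N)%N in NE.
have /coprimezP[[u v] /= uv] : coprimez e M by rewrite coprimezE /= coprimeXl.
have vM : v * M%:Z = 1 - u * e%:Z by rewrite -uv; ring.
have p3 : 3 * v * M + 2 * u * e = 3 - u * e by rewrite -mulrA vM; ring.
have p2 : 3 * v * M + 2 * u * e = 2 + v * M by rewrite -mulrA vM; ring.
pose p : int := 3 * v * M + 2 * u * e.
have /coprimezP[[t q] /= tq] : coprimez p N.
  rewrite NE PoszM coprimezMr; apply/andP; split.
    rewrite /p p2 addrC coprimez_sym /coprimez gcdzMDl.
    by rewrite coprime_sym in cM.
  rewrite /p p3 -mulNr addrC coprimez_sym /coprimez gcdzMDl.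
  by rewrite -/(coprimez _ _) coprimezE /= coprimeXl.
exists p, (- q), t, ((6 * u - u ^+ 2 * e) * - (4 * v + v ^+ 2 * M)).
exists (p ^+ 2 - 1 + M%:Z * - (4 * v + v ^+ 2 * M) + e%:Z * (6 * u - u ^+ 2 * e)).
split; first by rewrite -tq; ring.
have eE : 8 = p ^+ 2 - 1 + e%:Z * (6 * u - u ^+ 2 * e) by rewrite /p p3; ring.
have ME : 3 = p ^+ 2 - 1 + M%:Z * - (4 * v + v ^+ 2 * M) by rewrite /p p2; ring.
rewrite [RHS](_ : _ = 8 * 3) // [in RHS]eE [in RHS]ME NE PoszM; ring.
Qed.

Lemma Norm_form N g (a b c d : R) : (0 < N)%N ->
  (g : 'M_2) = mx2 a b c d -> g \in NormGamma0 N ->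
  [/\ [/\ a ^+ 2 \is a Num.int, a * c \is a Num.int, c ^+ 2 / N%:R \is a Num.int,
          N%:R * b ^+ 2 \is a Num.int & d ^+ 2 \is a Num.int],
      24 * (a * b) \is a Num.int, 24 * (b * c) \is a Num.int
    & 24 * (c * d / N%:R) \is a Num.int].
Proof.
move=> N0 Eg Ng.
have det : a * d - b * c = 1.
  by have := SL2_det g; rewrite Eg det_mx2 => /eqP.
have conj p q r t := @Norm_conj_int N g a b c d p q r t N0 Eg Ng.
have [|T1 T2 T3] := conj 1 1 0 1; first by ring.
have [|V1 V2 V3] := conj 1 0 1 1; first by ring.
rewrite ?subrr ?(mulr0z, mulr1z) in T1 T2 T3 V1 V2 V3.
have aa : a ^+ 2 \is a Num.int by rewrite !mul0r mul1r subr0 add0r in T2.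
have ac : a * c \is a Num.int.
  rewrite !mul1r !mul0r addr0 addrAC det in T1.
  by rewrite -[a * c](subKr 1); rewrite rpredB // ?rpred1.
have cc : c ^+ 2 / N%:R \is a Num.int.
  by move: T3; rewrite !mul0r mul1r !add0r rpredN.
have bb : N%:R * b ^+ 2 \is a Num.int.
  by move: V2; rewrite !mul0r mul1r sub0r addr0 rpredN.
have dd : d ^+ 2 \is a Num.int by move: V3; rewrite !mul0r mul1r add0r subr0.
have bd : N%:R * (b * d) \is a Num.int.
  move: V1; rewrite !mul1r mul0r subr0 addrAC det => V1.
  by rewrite -[N%:R * _](addKr 1) rpredD // rpredN rpred1.
(* These multipliers form an ideal. It contains p - t whenever p t is 1 modulo N, and the aim is to
   find 24 in it. *)
pose I (e : int) := [/\ e%:~R * (a * b) \is a Num.int, e%:~R * (b * c) \is a Num.int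
  & e%:~R * (c * d / N%:R) \is a Num.int].
have ID e f : I e -> I f -> I (e + f).
  by move=> [e1 e2 e3] [f1 f2 f3]; rewrite /I rmorphD !mulrDl; split; rewrite rpredD.
have IM e f : I e -> I (f * e).
  by move=> [e1 e2 e3]; rewrite /I rmorphM; split; rewrite -mulrA rpredM ?intr_int.
have Ipt p q t : p * t - q * N%:Z = 1 -> I (p - t).
  move=> D; have [|e1 e2 e3] := conj p q 1 t; first by rewrite mulr1.
  rewrite mulr1z !mul1r in e1 e2 e3; split.
  - rewrite -[p - t]opprB rmorphN mulNr rpredN.
    have -> : (t - p)%:~R * (a * b) = ((t - p)%:~R * (a * b) - N%:R * b ^+ 2 +
       q%:~R * a ^+ 2) + N%:R * b ^+ 2 - q%:~R * a ^+ 2 by ring.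
    by apply: rpredB; [apply: (rpredD e2 bb)|rewrite rpredM ?intr_int].
  - have -> : (p - t)%:~R * (b * c) = (p%:~R * (a * d) + N%:R * (b * d)
       - q%:~R * (a * c) - t%:~R * (b * c)) - p%:~R * (a * d - b * c)
       - N%:R * (b * d) + q%:~R * (a * c) by rewrite rmorphB /=; ring.
    rewrite det mulr1; apply: rpredD; last by rewrite rpredM ?intr_int.
    by apply: rpredB bd; apply: rpredB e1 _; rewrite intr_int.
  - have -> : (p - t)%:~R * (c * d / N%:R) = ((p - t)%:~R * (c * d / N%:R) + d ^+ 2
       - q%:~R * (c ^+ 2 / N%:R)) - d ^+ 2 + q%:~R * (c ^+ 2 / N%:R) by ring.
    by apply: rpredD; [exact: rpredB|rewrite rpredM ?intr_int].
have [p [q [t [k [l [D E24]]]]]] := ex_unit_24 N0.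
have I1 := Ipt _ _ _ D.
have IN : I N.
  have -> : N%:Z = (p - t) + (-1) * (p - (t + N)) by ring.
  apply: ID => //; apply: IM; apply: (Ipt _ (q + p)).
  by rewrite -[RHS]D; ring.
have I24 : I 24.
  rewrite -E24 mulrC; apply: (ID _ _ (IM _ _ IN)); rewrite mulrC; apply: (IM).
  have -> : p ^+ 2 - 1 = p * (p - t) + q * N by rewrite -D; ring.
  by apply: ID; apply: (IM).
by case: I24.
Qed.

Lemma int_ratio_dvdz (x m : int) : m != 0 -> x%:~R / m%:~R \is a @Num.int R ->
  (m %| x)%Z.
Proof.
move=> m0 /intrP[k /(congr1 ( *%R^~ m%:~R))]; rewrite divfK ?intr_eq0 //.
by rewrite -rmorphM => /intr_inj ->; rewrite dvdz_mull.
Qed.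

Lemma Norm_prim_form N g : (0 < N)%N -> g \in NormGamma0 N ->
  exists (s : R) (a b c d x y z t : int),
  let m := a * d - b * c in
  [/\ s *: (g : 'M_2) = mx2 a%:~R b%:~R c%:~R d%:~R, s ^+ 2 = m%:~R, s != 0,
      x * a + y * b + z * c + t * d = 1 &
      [/\ [/\ (m %| a ^+ 2)%Z, (m %| a * c)%Z, (m * N%:Z %| c ^+ 2)%Z,
              (m %| N%:Z * b ^+ 2)%Z & (m %| d ^+ 2)%Z],
          (m %| 24 * (a * b))%Z, (m %| 24 * (b * c))%Z
        & (m * N%:Z %| 24 * (c * d))%Z]].
Proof.
move=> N0 Ng; have NZ : N%:Z != 0 by rewrite -lt0n.
pose al := (g : 'M_2) 0 0; pose be := (g : 'M_2) 0 1.
pose ga := (g : 'M_2) 1 0; pose de := (g : 'M_2) 1 1.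
have Eg : (g : 'M_2) = mx2 al be ga de := mx2P _.
have det : al * de - be * ga = 1.
  by have := SL2_det g; rewrite Eg det_mx2 => /eqP.
have [[f1 f2 f3 f4 f5] f6 f7 f8] := Norm_form N0 Eg Ng.
have NR : N%:R != 0 :> R by rewrite pnatr_eq0 -lt0n.
have gg : ga ^+ 2 \is a Num.int by rewrite -[_ ^+ 2](divfK NR) rpredM ?natr_int.
have gd : 24 * (ga * de) \is a Num.int.
  by rewrite -[ga * de](divfK NR) mulrA rpredM ?natr_int.
have ad : 24 * (al * de) \is a Num.int.
  have -> : 24 * (al * de) = 24 * (al * de - be * ga) + 24 * (be * ga) by ring.
  by rewrite det mulr1 rpredD ?natr_int.
(* A nonzero entry of the first column serves as scale: 24 times its product with any entry is
   already known to be an integer. *)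
have [x x0 [xa xb xc xd]] : exists2 x, x != 0 & [/\ 24 * (x * al) \is a Num.int,
    24 * (x * be) \is a Num.int, 24 * (x * ga) \is a Num.int
  & 24 * (x * de) \is a Num.int].
  have [al0|al0] := eqVneq al 0.
    exists ga.
      by apply: contraTneq (oner_neq0 R) => ga0; rewrite -det al0 ga0 mul0r mulr0 subrr eqxx.
    split=> //; first by rewrite mulrC (mulrC ga) -mulrC rpredM ?natr_int.
      by rewrite (mulrC ga).
    by rewrite rpredM ?natr_int.
  by exists al => //; split=> //; rewrite rpredM ?natr_int.
have s0 : 24 * x != 0 by rewrite mulf_neq0 ?pnatr_eq0.
move: xa xb xc xd => /intrP[a1 aE] /intrP[b1 bE] /intrP[c1 cE] /intrP[d1 dE].
have [|s [a [b [c [d [x' [y [z [t [E s2 s1 B]]]]]]]]]] :=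
    @prim_formP R g (24 * x) a1 b1 c1 d1 s0.
  by rewrite Eg scale_mx2 -!mulrA aE bE cE dE.
exists s, a, b, c, d, x', y, z, t; set m := a * d - b * c in s2 *.
have m0 : m != 0 by rewrite -(intr_eq0 R) -s2 expf_neq0.
have [aE' bE' cE' dE'] : [/\ a%:~R = s * al, b%:~R = s * be, c%:~R = s * ga
    & d%:~R = s * de].
  by apply: mx2_inj; rewrite -E Eg scale_mx2.
have mR : m%:~R != 0 :> R by rewrite intr_eq0.
have ratio (e : int) (r : R) : r \is a Num.int -> e%:~R = s ^+ 2 * r -> (m %| e)%Z.
  by move=> rZ eE; apply: int_ratio_dvdz m0 _; rewrite eE s2 mulrC mulKf.
have ratioN (e : int) (r : R) : r / N%:R \is a Num.int -> e%:~R = s ^+ 2 * r ->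
    (m * N%:Z %| e)%Z.
  move=> rZ eE; apply: int_ratio_dvdz; first by rewrite mulf_neq0.
  by rewrite eE s2 rmorphM /= -pmulrn -mulf_div mulfV // mul1r.
split=> //; split; first split.
- by apply: ratio f1 _; rewrite rmorphXn /= aE' exprMn.
- by apply: ratio f2 _; rewrite rmorphM /= aE' cE'; ring.
- by apply: ratioN f3 _; rewrite rmorphXn /= cE' exprMn.
- by apply: ratio f4 _; rewrite rmorphM rmorphXn /= bE' -pmulrn; ring.
- by apply: ratio f5 _; rewrite rmorphXn /= dE' exprMn.
- by apply: ratio f6 _; rewrite !rmorphM /= aE' bE'; ring.
- by apply: ratio f7 _; rewrite !rmorphM /= bE' cE'; ring.
- apply: (@ratioN _ (24 * (ga * de))); first by rewrite -mulrA.
  by rewrite !rmorphM /= dE' cE'; ring.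
Qed.

End Normalizer.

(** * Local generation *)

(** Here k, n and D are the valuations of the determinant, of N and of 24. If va + vd = k, then va =
    vd = k / 2 and the matrix has the shape of [loc]. Otherwise b c has valuation exactly k; if k >
    0, primitivity makes b a unit and forces k = n, the shape of w times such a matrix. *)
Lemma valuation_cases (k n D mu va vb vc vd : nat) :
  (k <= va + va)%N -> (k + n <= vc + vc)%N -> (k <= n + vb + vb)%N ->
  (k <= vd + vd)%N -> (k <= D + va + vb)%N -> (k <= D + vb + vc)%N ->
  (k + n <= D + vc + vd)%N -> (va + vd <= k)%N || (vb + vc <= k)%N ->
  (k <= vb + vc)%N -> [|| va == 0, vb == 0, vc == 0 | vd == 0]%N ->
  (mu <= D)%N -> (2 * mu <= n)%N -> (mu == D) || (n < 2 * mu + 2)%N ->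
  (exists2 j, k = (2 * j)%N &
     [/\ j <= va, j <= mu + vb, j + (n - mu) <= vc & j <= vd]%N) \/
  [/\ k = n, n - mu <= va, n <= vc & n - mu <= vd]%N.
Proof.
move=> h1 h3 h4 h5 h6 h7 h8 hm hbc hmin muD mun mu2.
have [vadk|vadk] := eqVneq (va + vd)%N k; [left|case: (posnP k) => [k0|k_gt0]].
- have [kE dE] : k = (2 * va)%N /\ vd = va by move: vadk h1 h5; clear; lia.
  have [va0|[vb0 va_gt0]] : va = 0%N \/ vb = 0%N /\ (0 < va)%N.
      by move: hmin h3; rewrite dE kE; clear; lia.
    exists 0%N; first by rewrite kE va0.
    by split=> //; move: h3 h8 muD mun mu2; rewrite kE dE va0; clear; lia.
  exists va => //; rewrite leqnn dE leqnn; split=> //.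
    by move: h4 h6 muD mun mu2; rewrite kE vb0; clear; lia.
  by move: h8 h3 muD mun mu2; rewrite kE dE; clear; lia.
- left; exists 0%N => //; have [n0 mu0] : n = 0%N /\ mu = 0%N.
    by move: h1 h5 vadk hm h3 mun; rewrite k0; clear; lia.
  by rewrite n0.
- have bck : (vb + vc)%N = k by move: h1 h5 vadk hm hbc; clear; lia.
  have vb0 : vb = 0%N by move: k_gt0 h1 h3 h5 hmin; clear; lia.
  have kn : k = n by move: h4 h3 bck; rewrite vb0; clear; lia.
  rewrite vb0 in bck h6 h7; rewrite add0n in bck; subst vc n; right; split=> //.
    by move: h1 h6 mun mu2; clear; lia.
  by move: h5 h8 mun mu2; clear; lia.
Qed.

(** * Valuations of the entries of a primitive multiple *)

Section Valuations.
Local Open Scope ring_scope.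
Variable p : nat.
Hypothesis p_pr : prime p.

(* B stands for the infinite valuation of 0. *)
Definition valz (B : nat) (x : int) : nat :=
  if x == 0 then B else logn p (absz x).

Lemma dvdz_valz B i (x : int) : (i <= B)%N ->
  ((p ^ i)%:Z %| x)%Z = (i <= valz B x)%N.
Proof.
move=> iB; rewrite /valz; have [->|x0] := eqVneq x 0; first by rewrite dvdz0.
by rewrite dvdzE /= pfactor_dvdn // absz_gt0.
Qed.

Lemma dvdz_valzM B i (x y : int) : (i <= B)%N ->
  ((p ^ i)%:Z %| x * y)%Z = (i <= valz B x + valz B y)%N.
Proof.
move=> iB; rewrite /valz; have [->|x0] := eqVneq x 0.
  by rewrite mul0r dvdz0 (leq_trans iB) ?leq_addr.
have [->|y0] := eqVneq y 0; first by rewrite mulr0 dvdz0 (leq_trans iB) ?leq_addl.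
by rewrite dvdzE /= abszM pfactor_dvdn ?lognM // ?muln_gt0 ?absz_gt0 ?x0.
Qed.

Lemma Norm_valuations N (a b c d x y z t : int) :
  let m := a * d - b * c in
  let n := logn p N in
  let mu := minn (logn p 24) (n %/ 2) in
  let k := logn p (absz m) in
  (0 < N)%N -> m != 0 -> x * a + y * b + z * c + t * d = 1 ->
  [/\ [/\ (m %| a ^+ 2)%Z, (m %| a * c)%Z, (m * N%:Z %| c ^+ 2)%Z,
              (m %| N%:Z * b ^+ 2)%Z & (m %| d ^+ 2)%Z],
          (m %| 24 * (a * b))%Z, (m %| 24 * (b * c))%Z
        & (m * N%:Z %| 24 * (c * d))%Z] ->
  (exists2 j, k = (2 * j)%N & [/\ ((p ^ j)%:Z %| a)%Z, ((p ^ j)%:Z %| (p ^ mu)%:Z * b)%Z,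
      ((p ^ (j + (n - mu)))%:Z %| c)%Z & ((p ^ j)%:Z %| d)%Z]) \/
  [/\ k = n, ((p ^ (n - mu))%:Z %| a)%Z, ((p ^ n)%:Z %| c)%Z
    & ((p ^ (n - mu))%:Z %| d)%Z].
Proof.
move=> m n mu k N0 m0 B [[f1 f2 f3 f4 f5] f6 f7 f8].
have NZ : N%:Z != 0 by rewrite -lt0n.
(* [big] is at least every exponent tested below, so a zero entry passes each test as an infinite
   valuation would. *)
pose D := logn p 24; pose big := (k + n + D).+1.
have val_exact (e : int) : e != 0 -> valz big e = logn p (absz e).
  by rewrite /valz => /negPf ->.
have pm : ((p ^ k)%:Z %| m)%Z by rewrite dvdzE; exact: pfactor_dvdnn.
have pmN : ((p ^ (k + n))%:Z %| m * N%:Z)%Z.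
  by rewrite expnD PoszM dvdz_mul // dvdzE /=; exact: pfactor_dvdnn.
have pm' : ~~ ((p ^ k.+1)%:Z %| m)%Z.
  by rewrite dvdzE /= pfactor_dvdn ?absz_gt0 // ltnn.
have vN : valz big N = n by rewrite val_exact.
have v24 : valz big 24 = D by rewrite val_exact.
have dv3 (i : nat) (e f g : int) : (i <= big)%N -> ((p ^ i)%:Z %| e * (f * g))%Z ->
    (i <= valz big e + valz big f + valz big g)%N.
  move=> iB; have [->|e0] := eqVneq e 0; first by rewrite {1}/valz eqxx -addnA (leq_trans iB) ?leq_addr.
  have [->|f0] := eqVneq f 0; first by rewrite {2}/valz eqxx addnAC (leq_trans iB) ?leq_addl.
  have [->|g0] := eqVneq g 0; first by rewrite {3}/valz eqxx (leq_trans iB) ?leq_addl.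
  rewrite !val_exact // dvdzE /= !abszM pfactor_dvdn ?lognM //;
    by rewrite ?muln_gt0 ?absz_gt0 ?e0 ?f0 ?g0 // addnA.
have k1B : (k.+1 <= big)%N by rewrite ltnS -addnA leq_addr.
have kB := ltnW k1B.
have knB : (k + n <= big)%N by rewrite leqW // leq_addr.
rewrite !expr2 in f1 f3 f4 f5.
have h1 := dvdz_trans pm f1; rewrite (@dvdz_valzM big) // in h1.
have h3 := dvdz_trans pmN f3; rewrite (@dvdz_valzM big) // in h3.
have h4 := dv3 _ _ _ _ kB (dvdz_trans pm f4).
have h5 := dvdz_trans pm f5; rewrite (@dvdz_valzM big) // in h5.
have h6 := dv3 _ _ _ _ kB (dvdz_trans pm f6).
have h7 := dv3 _ _ _ _ kB (dvdz_trans pm f7).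
have h8 := dv3 _ _ _ _ knB (dvdz_trans pmN f8).
rewrite vN in h4; rewrite v24 in h6 h7 h8.
have hm : ~~ ((k < valz big a + valz big d) && (k < valz big b + valz big c))%N.
  apply: contra pm' => /andP[ad bc].
  by rewrite /m rpredB //= -/(dvdz _ _) ?(@dvdz_valzM big).
have hbc : (k <= valz big b + valz big c)%N.
  rewrite -(@dvdz_valzM big) //.
  have -> : b * c = a * d - m by rewrite /m; ring.
  by rewrite rpredB // (@dvdz_valzM big) //; move: h1 h5; clear; lia.
have hmin : [|| valz big a == 0, valz big b == 0, valz big c == 0 | valz big d == 0]%N.
  apply: contraLR isT; rewrite !negb_or -!lt0n => /and4P[va vb vc vd].
  have pe e : (0 < valz big e)%N -> (p %| e)%Z.
    by move=> ve; rewrite -[p]expn1 (@dvdz_valz big).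
  have : (p %| x * a + y * b + z * c + t * d)%Z.
    by rewrite !rpredD // dvdz_mull // pe.
  by rewrite B dvdz1 absz_nat => /eqP p1; have := prime_gt1 p_pr; rewrite p1.
have dv i (e : int) : (i <= k + n)%N -> (i <= valz big e)%N -> ((p ^ i)%:Z %| e)%Z.
  by move=> iB; rewrite (@dvdz_valz big) // (leq_trans iB).
have dvmu i : (i <= k)%N -> (i <= mu + valz big b)%N -> ((p ^ i)%:Z %| (p ^ mu)%:Z * b)%Z.
  have [im|im] := leqP i mu.
    by move=> _ _; apply: dvdz_mulr; rewrite dvdzE /= dvdn_exp2l.
  move=> ik ib.
  rewrite -(subnKC (ltnW im)) expnD PoszM dvdz_mul // dv ?leq_subLR //.
  by rewrite (leq_trans ik) // addnCA leq_addr.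
have muD : (mu <= D)%N by rewrite geq_minl.
have mun : (2 * mu <= n)%N by rewrite mulnC (leq_trans _ (leq_trunc_div n 2)) // leq_mul2r geq_minr.
have mu2 : (mu == D) || (n < 2 * mu + 2)%N.
  by rewrite /mu -/D; move: (D) (n); clear; lia.
have {}hm : (valz big a + valz big d <= k)%N || (valz big b + valz big c <= k)%N.
  by move: hm; rewrite negb_and -!leqNgt.
have [[j kE [ja jb jc jd]]|[kE na nc nd]] :=
    valuation_cases h1 h3 h4 h5 h6 h7 h8 hm hbc hmin muD mun mu2.
  have jk : (j <= k)%N by rewrite kE leq_pmull.
  left; exists j => //; split; [apply: dv|apply: dvmu|apply: dv|apply: dv] => //;
    rewrite ?(leq_trans jk) ?leq_addr //.
  by rewrite leq_add ?leq_subr.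
have nk : (n <= k + n)%N by rewrite leq_addl.
by right; split=> //; apply: dv => //; rewrite (leq_trans (leq_subr _ _)).
Qed.

End Valuations.

(** * Explicit matrices for w and the shifts, and clearing the off-diagonal entries *)

Section LocalElements.
Local Open Scope ring_scope.
Variables (R : realType) (N p : nat).
Hypothesis N_gt0 : (0 < N)%N.
Hypothesis p_pr : prime p.
Let n := logn p N.
Let M := (N %/ p ^ n)%N.

Lemma pfactor_cofactor : (N = p ^ n * M)%N /\ coprime p M.
Proof.
have [M' cM' NE] := pfactor_coprime p_pr N_gt0.
have -> : M = M' by rewrite /M {1}NE mulnK // expn_gt0 prime_gt0.
by rewrite mulnC.
Qed.

(** The class does not depend on choices, so a representative with a = b = 1 may be fixed. Its
    determinant condition makes M c0 congruent to -1 modulo p^n, which later removes N from the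
    reductions. *)
Lemma w_cl_matrix : exists (W : Norm R N) (c0 d0 : int),
  [/\ w_cl R N (p ^ n) = \pi_(NQuot R N)%qT W, (p ^ n)%:Z * d0 - M%:Z * c0 = 1 &
      (val W : 'M_2) = (Num.sqrt (p ^ n)%:R)^-1 *:
         mx2 (p ^ n)%:R 1 (N%:Z * c0)%:~R ((p ^ n)%:Z * d0)%:~R].
Proof.
have [NE cM] := pfactor_cofactor.
have m_gt0 : (0 < p ^ n)%N by rewrite expn_gt0 prime_gt0.
have mN : (p ^ n %| N)%N := pfactor_dvdnn p N.
have cop : coprime (p ^ n) (N %/ p ^ n) by rewrite coprimeXl.
have /coprimezP[[d0 c0] /= B] : coprimez (p ^ n)%N M by rewrite coprimezE.
have m0 : (0 <= (p ^ n)%:R :> R) by rewrite ler0n.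
have s2 := sqr_sqrtr m0.
have s0 : Num.sqrt (p ^ n)%:R != 0 :> R.
  by apply: contraTneq m_gt0 => s0; rewrite -(ltr0n R) -s2 s0 expr0n ltxx.
pose A : 'M[R]_2 := (Num.sqrt (p ^ n)%:R)^-1 *:
   mx2 (p ^ n)%:R 1 (N%:Z * - c0)%:~R ((p ^ n)%:Z * d0)%:~R.
have B' : (p ^ n)%:Z * d0 - M%:Z * - c0 = 1 by rewrite -B; ring.
have dA : \det A == 1.
  have BR : (p ^ n)%:R * d0%:~R - M%:R * (- c0)%:~R = 1 :> R.
    by rewrite [RHS](_ : _ = 1%:~R) // -B' rmorphB !rmorphM.
  rewrite /A scale_mx2 det_mx2 !rmorphM /= -?pmulrn NE natrM.
  set s := Num.sqrt _ in s0 s2 *.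
  by rewrite -[X in _ == X]BR -s2; apply/eqP; field.
have ALA : AL_form N (p ^ n) (MkSL2 dA).
  by exists 1, 1, (- c0), d0; rewrite /= mulr1.
pose W := MkNorm (AL_Norm mN ALA).
exists W, (- c0), d0; split=> //.
have : @AL_class R N (p ^ n) (\pi_(NQuot R N)%qT W) by exists W.
by rewrite (w_clP R m_gt0 mN cop) => <-.
Qed.

Variables (mu nu : nat).
Hypothesis nE : n = (2 * mu + nu)%N.

Lemma Norm_loc (W g : SL2 R) (c0 d0 : int) :
  mu = minn (logn p 24) (n %/ 2) ->
  (p ^ n)%:Z * d0 - M%:Z * c0 = 1 ->
  (W : 'M_2) = (Num.sqrt (p ^ n)%:R)^-1 *:
         mx2 (p ^ n)%:R 1 (N%:Z * c0)%:~R ((p ^ n)%:Z * d0)%:~R ->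
  g \in NormGamma0 N -> loc p mu nu g \/ loc p mu nu (W^-1 * g)%g.
Proof.
move=> muE BW EW Ng; have [NE cM] := pfactor_cofactor.
have [s [a [b [c [d [x [y [z [t [E s2 s0 B dvd]]]]]]]]]] := Norm_prim_form N_gt0 Ng.
have m0 : a * d - b * c != 0 by rewrite -(intr_eq0 R) -s2 expf_neq0.
have := Norm_valuations p_pr N_gt0 m0 B dvd; rewrite -/n -muE.
have nmu : (n - mu = mu + nu)%N by lia.
have pZ k : (p ^ k)%:Z != 0 by rewrite -lt0n expn_gt0 prime_gt0.
have pR := @prime_expR_neq0 R p p_pr.
have not_dvd k (e : int) : logn p (absz (a * d - b * c)%R) = k ->
    a * d - b * c = (p ^ k)%:Z * e -> ~~ (p %| e)%Z.
  move=> <-; set k' := logn _ _ => eE.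
  have : ~~ ((p ^ k'.+1)%:Z %| a * d - b * c)%Z.
    by rewrite dvdzE /= pfactor_dvdn ?absz_gt0 // ltnn.
  by rewrite eE expnSr PoszM dvdz_mul2l ?pZ.
rewrite nmu => -[[j kE [/dvdzP[a' aE] /dvdzP[b' bE] /dvdzP[c' cE] /dvdzP[d' dE]]]|].
  left; exists (s / (p ^ j)%:R), a', b', c', d'; split.
    apply: (not_dvd _ _ kE); apply: (mulfI (pZ mu)).
    have -> : (p ^ mu)%:Z * (a * d - b * c) = (p ^ mu)%:Z * (a * d) - ((p ^ mu)%:Z * b) * c.
      by ring.
    by rewrite aE bE cE dE mul2n -addnn !expnD !PoszM; ring.
  have bR : b%:~R = b'%:~R * (p ^ j)%:R / (p ^ mu)%:R :> R.
    apply: (mulfI (pR mu)); rewrite [RHS]mulrC divfK //.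
    by have := congr1 (fun e : int => e%:~R : R) bE; rewrite !rmorphM /= -!pmulrn.
  rewrite mulrC -scalerA E scale_mx2 bR aE cE dE expnD PoszM.
  by congr (mx2 _ _ _ _); rewrite ?rmorphM /= -?pmulrn; field; rewrite ?pR.
move=> [kE /dvdzP[a' aE] /dvdzP[c' cE] /dvdzP[d' dE]]; right.
pose r : R := Num.sqrt (p ^ n)%:R.
have r2 : r ^+ 2 = (p ^ n)%:R by rewrite sqr_sqrtr // ler0n.
have r0 : r != 0 by have := pR n; rewrite -r2 expf_eq0.
(* Dividing r W^-1 (s g) by p^n leaves exactly the shape required by [loc], whence this scale. *)
exists (s * r / (p ^ n)%:R), (d0 * a - c'), ((p ^ mu)%:Z * d0 * b - d').
exists (- M%:Z * c0 * a' + (p ^ mu)%:Z * c'), (- M%:Z * c0 * b + d); split.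
  apply: (not_dvd _ _ kE); rewrite -[LHS]mul1r -BW aE cE dE nE mul2n -addnn !expnD !PoszM.
  by ring.
have EW' : (W : 'M_2) = mx2 (r^-1 * (p ^ n)%:R) r^-1 (r^-1 * (N%:Z * c0)%:~R)
   (r^-1 * ((p ^ n)%:Z * d0)%:~R) by rewrite EW scale_mx2 mulr1.
rewrite SL2_mulE [s * r]mulrC -[r * s * _]mulrA [s / _]mulrC mulrA -scalerA.
rewrite scalemxAr E (SL2_invE EW') mul_mx2 scale_mx2.
have nR : (p ^ n)%:R = (p ^ mu)%:R * (p ^ mu)%:R * (p ^ nu)%:R :> R.
  by rewrite nE mul2n -addnn !expnD !natrM.
by congr (mx2 _ _ _ _); rewrite ?aE ?cE ?dE ?[in N%:Z]NE ?PoszM !(rmorphD, rmorphM, rmorphN, rmorphB) /=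
  -?pmulrn ?expnD ?natrM ?nR; field; rewrite ?r0 ?pR.
Qed.

Let pcop (M' c0 d0 : int) : (0 < mu)%N -> (p ^ n)%:Z * d0 - M' * c0 = 1 ->
  ~~ (p %| M' * c0)%Z.
Proof.
move=> mu_gt0 B; apply/negP => pM.
have : (p %| (p ^ n)%:Z * d0 - M' * c0)%Z.
  rewrite rpredB // dvdz_mulr // dvdzE /= dvdn_exp //.
  by rewrite nE addn_gt0 muln_gt0 mu_gt0.
by rewrite B dvdz1 absz_nat => /eqP p1; have := prime_gt1 p_pr; rewrite p1.
Qed.

Lemma coprimez_expl k (e : int) : (0 < k)%N -> coprimez (p ^ k)%N e = ~~ (p %| e)%Z.
Proof.
by move=> k0; rewrite coprimezE /= coprime_pexpl // prime_coprime // dvdzE.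
Qed.

Lemma coprimez_solve (u : nat) (e f : int) : (0 < u)%N -> coprimez u f ->
  exists l : nat, (u %| e + l%:Z * f)%Z.
Proof.
move=> u0 /coprimezP[[x y] /= xy]; have uZ : u%:Z != 0 by rewrite -lt0n.
exists (absz ((- e * y) %% u)%Z); rewrite gez0_abs ?modz_ge0 //.
apply/dvdz_mod0P; rewrite -modzDmr modzMml modzDmr; apply/dvdz_mod0P.
suff -> : e + - e * y * f = e * x * u by rewrite dvdz_mull.
by rewrite -mulrA -[e * x * u]mulrA -[x * u](addrK (y * f)) xy; ring.
Qed.

(** Conjugation by W turns the upper shift into one that acts on the lower left entry: since M c0 is
    -1 modulo p^n, that entry is p^(mu + nu) times a number congruent to -l. *)
Lemma conj_shift_matrix (W Sl : SL2 R) (c0 d0 X : int) (l : nat) :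
  X = (p ^ (mu + nu))%:Z * M%:Z * c0 ->
  (p ^ n)%:Z * d0 - M%:Z * c0 = 1 ->
  (W : 'M_2) = (Num.sqrt (p ^ n)%:R)^-1 *:
         mx2 (p ^ n)%:R 1 (N%:Z * c0)%:~R ((p ^ n)%:Z * d0)%:~R ->
  (Sl : 'M_2) = mx2 1 (l%:R / (p ^ mu)%:R) 0 1 ->
  ((W * Sl * W^-1)%g : 'M_2) =
    mx2 (1 - l%:R * X%:~R) (l%:R * (p ^ (mu + nu))%:R)
        (- l%:R * (p ^ (mu + nu))%:R * (M%:R * c0%:~R) ^+ 2) (1 + l%:R * X%:~R).
Proof.
move=> -> BW EW ESl; have [NE cM] := pfactor_cofactor.
pose r : R := Num.sqrt (p ^ n)%:R.
have r2 : r ^+ 2 = (p ^ n)%:R by rewrite sqr_sqrtr // ler0n.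
have r0 : r != 0.
  by have := prime_expR_neq0 R p_pr n; rewrite -r2 expf_eq0.
have nR : (p ^ n)%:R = (p ^ mu)%:R * (p ^ mu)%:R * (p ^ nu)%:R :> R.
  by rewrite nE mul2n -addnn !expnD !natrM.
have BR : (p ^ n)%:R * d0%:~R = 1 + M%:R * c0%:~R :> R.
  by rewrite [X in _ = X + _](_ : _ = 1%:~R) // -BW rmorphB !rmorphM /= subrK.
have EWi : ((W^-1)%g : 'M_2) = r^-1 *:
    mx2 ((p ^ n)%:Z * d0)%:~R (- 1) (- (N%:Z * c0)%:~R) (p ^ n)%:R.
  by rewrite scale_mx2 !mulrN mulr1; apply: SL2_invE; rewrite EW scale_mx2 mulr1.
have pR := @prime_expR_neq0 R p p_pr.
rewrite !SL2_mulE ESl EWi EW -!scalemxAl -scalemxAr scalerA -invfM -expr2 r2.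
rewrite !mul_mx2 scale_mx2 /X [N]NE !PoszM !rmorphM /= -?pmulrn BR nR !expnD !natrM.
by congr (mx2 _ _ _ _); field; rewrite !pR.
Qed.

Lemma loc_reduce (W g : SL2 R) (c0 d0 : int) (s : R) (a b c d : int) :
  (p ^ n)%:Z * d0 - M%:Z * c0 = 1 ->
  (W : 'M_2) = (Num.sqrt (p ^ n)%:R)^-1 *:
         mx2 (p ^ n)%:R 1 (N%:Z * c0)%:~R ((p ^ n)%:Z * d0)%:~R ->
  s *: (g : 'M_2) = mx2 a%:~R (b%:~R / (p ^ mu)%:R)
                        ((p ^ (mu + nu))%:Z * c)%:~R d%:~R ->
  ~~ (p %| a * d - (p ^ nu)%:Z * b * c)%Z -> ~~ (p %| d)%Z \/ mu = 0%N ->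
  exists i l : nat, forall Si Sl : SL2 R,
    (Si : 'M_2) = mx2 1 (i%:R / (p ^ mu)%:R) 0 1 ->
    (Sl : 'M_2) = mx2 1 (l%:R / (p ^ mu)%:R) 0 1 ->
    loc p 0 n (W * Sl * W^-1 * (Si * g))%g.
Proof.
move=> BW EW E D dmu; have [NE cM] := pfactor_cofactor.
have u_gt0 : (0 < p ^ mu)%N by rewrite expn_gt0 prime_gt0.
have [i /dvdzP[b2 b2E]] : exists i : nat, ((p ^ mu)%N %| b + i%:Z * d)%Z.
  apply: coprimez_solve => //; case: dmu => [pd|->]; last by rewrite coprimezE /= coprime1n.
  by rewrite coprimezE /= coprimeXl // prime_coprime // -dvdzE.
pose a1 := a + i%:Z * (p ^ nu)%:Z * c.
pose X := (p ^ (mu + nu))%:Z * M%:Z * c0.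
have D1 : a1 * d - (p ^ nu)%:Z * ((p ^ mu)%:Z * b2) * c = a * d - (p ^ nu)%:Z * b * c.
  by rewrite [_ * b2]mulrC -b2E /a1; ring.
have [l /dvdzP[c2 c2E]] :
    exists l : nat, ((p ^ mu)%N %| c + l%:Z * (X * c - (M%:Z * c0) ^+ 2 * a1))%Z.
  apply: coprimez_solve => //; have [->|mu_gt0] := posnP mu.
    by rewrite coprimezE /= coprime1n.
  have pmu e : (p %| (p ^ mu)%:Z * e)%Z by rewrite dvdz_mulr // dvdzE /= dvdn_exp.
  rewrite coprimez_expl //.
  (* Once b has become a multiple of p^mu, the determinant is a1 d modulo p, so a1 is prime to p;
     this makes the coefficient of l invertible modulo p^mu. *)
  have pa : ~~ (p %| a1)%Z.
    apply: contra D => pa; rewrite -D1 mulrCA.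
    by apply: rpredB; [exact: dvdz_mulr|rewrite -mulrA pmu].
  apply/negP => H; have : (p %| (M%:Z * c0) ^+ 2 * a1)%Z.
    have -> : (M%:Z * c0) ^+ 2 * a1 = X * c - (X * c - (M%:Z * c0) ^+ 2 * a1) by ring.
    by rewrite rpredB // /X expnD PoszM -!mulrA pmu.
  rewrite Euclid_dvdzM // (negPf pa) orbF expr2 Euclid_dvdzM // orbb.
  by rewrite (negPf (pcop mu_gt0 BW)).
exists i, l => Si Sl ESi ESl.
exists s, ((1 - l%:Z * X) * a1 + l%:Z * (p ^ (mu + nu))%:Z * (p ^ (mu + nu))%:Z * c).
exists ((1 - l%:Z * X) * b2 + l%:Z * (p ^ (mu + nu))%:Z * d), c2.
exists (- l%:Z * (p ^ (mu + nu))%:Z * (M%:Z * c0) ^+ 2 * b2 + (1 + l%:Z * X) * d); split.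
  set d' := _ + _ * d; set b' := _ + _ * d.
  have -> : (p ^ n)%:Z * b' * c2 = (p ^ (mu + nu))%:Z * b' * (c2 * (p ^ mu)%:Z).
    by rewrite nE mul2n -addnn -addnA expnD PoszM; ring.
  rewrite -c2E /b' /d'; apply: contra D; rewrite -D1 /X expnD PoszM.
  by congr (_ %| _)%Z; ring.
have uR := @prime_expR_neq0 R p p_pr mu.
have ESg : s *: ((Si * g)%g : 'M_2) = mx2 a1%:~R b2%:~R ((p ^ (mu + nu))%:Z * c)%:~R d%:~R.
  have bR : b2%:~R * (p ^ mu)%:R = b%:~R + i%:R * d%:~R :> R.
    by have /esym := congr1 (fun e : int => e%:~R : R) b2E; rewrite /= !(rmorphD, rmorphM).
  rewrite SL2_mulE scalemxAr E ESi mul_mx2 -[b2%:~R](mulfK uR) bR /a1 expnD.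
  by congr (mx2 _ _ _ _); rewrite ?PoszM ?(rmorphD, rmorphM) /= -?pmulrn; field.
have ET := conj_shift_matrix (erefl X) BW EW ESl.
rewrite SL2_mulE scalemxAr ESg ET mul_mx2 add0n divr1.
have -> : (p ^ n)%:Z * c2 = (p ^ (mu + nu))%:Z * (c2 * (p ^ mu)%:Z).
  by rewrite nE mul2n -addnn -addnA expnD PoszM; ring.
rewrite -c2E; congr (mx2 _ _ _ _);
  by rewrite ?PoszM !(rmorphD, rmorphB, rmorphN, rmorphM, rmorphXn, rmorph1) /= -?pmulrn; ring.
Qed.

End LocalElements.

(** * Gluing the local factors in the quotient *)

Section Quotient.
Local Open Scope group_scope.
Local Open Scope classical_set_scope.
Variables (R : realType) (N : nat).
Hypothesis N_gt0 : (0 < N)%N.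
Local Notation Q := (NQuot R N).
Local Notation pi := (\pi_(NQuot R N)%qT).
Implicit Types (g h : Norm R N) (x y z : Q) (p mu nu : nat).

Lemma pi_NQuotV g : pi g^-1 = (pi g)^-1.
Proof. exact: NQuot_invE. Qed.

Lemma NQuotW (P : Q -> Prop) : (forall g, P (pi g)) -> forall x, P x.
Proof. by move=> Pg x; rewrite -[x]reprK. Qed.

Definition locq p mu nu : set Q := [set x | exists2 g, pi g = x & loc p mu nu (val g)].

(** Gamma_0(N) is contained in this localization, so membership is independent of the
    representative. *)
Lemma locqP p mu nu g : prime p -> logn p N = (2 * mu + nu)%N ->
  locq p mu nu (pi g) -> loc p mu nu (val g).
Proof.
move=> p_pr nE [h /eqP]; rewrite NQuot_eq => hg lh.
rewrite -[g](mulVKg h) valM; apply: (loc_mul p_pr lh); apply: loc_widen => //.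
by rewrite -nE; exact: Gamma0_loc.
Qed.

Lemma locq_subgroup p mu nu : prime p -> is_subgroup (locq p mu nu).
Proof.
move=> p_pr; split; first by exists 1; rewrite ?val1 //; exact: loc_one.
move=> _ _ [g <- lg] [h <- lh]; exists (g / h); first by rewrite pi_NQuotM pi_NQuotV.
by rewrite gmulfM gmulfV; apply: (loc_mul p_pr lg); apply: loc_inv.
Qed.

Lemma locq_eq1 x : (forall p, prime p -> locq p 0 (logn p N) x) -> x = 1.
Proof.
elim/NQuotW: x => g lg; apply/esym/eqP; rewrite NQuot_eq invg1 mul1g.
by apply: loc_Gamma0 => // p p_pr; apply: locqP => //; exact: lg.
Qed.

Lemma S_clX (v : nat) i : (v %| 24)%N -> (v ^ 2 %| N)%N ->
  exists2 g, S_cl R N v ^+ i = pi g & (val g : 'M_2) = mx2 1%R (i%:R / v%:R)%R 0%R 1%R.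
Proof.
move=> v24 vN; elim: i => [|i [g Sg Eg]].
  by exists 1; rewrite // val1 /= mul0r scalar_mx2.
pose h := MkNorm (Sshift_Norm R v24 vN).
exists (g * h); first by rewrite expgSr Sg (@S_clP _ _ _ h) // pi_NQuotM.
rewrite gmulfM SL2_mulE Eg mul_mx2 -[i.+1]addn1 natrD.
by congr (mx2 _ _ _ _); ring.
Qed.

(** Multiplied by the square root of q^n, the representative becomes integral with determinant q^n,
    which is prime to p. *)
Lemma locq_w p q : prime p -> prime q -> p != q ->
  locq p 0 (logn p N) (w_cl R N (q ^ logn q N)).
Proof.
move=> p_pr q_pr pq; have [W [c0 [d0 [-> B EW]]]] := w_cl_matrix R N_gt0 q_pr.
exists W => //; set n := logn q N in B EW *; set M := (N %/ _)%N in B.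
have NE : N = (q ^ n * M)%N by have [] := pfactor_cofactor N_gt0 q_pr.
have /dvdnP[K KE] := pfactor_dvdnn p N.
have KZ : ((p ^ logn p N)%:Z * K%:Z = N%:Z)%R by rewrite -PoszM mulnC -KE.
pose r : R := Num.sqrt (q ^ n)%:R.
exists r, (q ^ n)%:Z%R, 1%R, (K%:Z * c0)%R, ((q ^ n)%:Z * d0)%R.
have r0 : (r != 0)%R by rewrite lt0r_neq0 // sqrtr_gt0 ltr0n expn_gt0 prime_gt0.
split; last first.
  rewrite EW scalerA divff // scale1r add0n divr1 mulrA KZ.
  by congr (mx2 _ _ _ _); rewrite -?pmulrn.
have -> : ((q ^ n)%:Z * ((q ^ n)%:Z * d0) - (p ^ logn p N)%:Z * 1 * (K%:Z * c0)
  = (q ^ n)%:Z)%R.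
  rewrite mulr1 [X in (_ - X)%R]mulrA KZ [N in LHS]NE PoszM -[RHS]mulr1 -B.
  by ring.
apply: contra pq; rewrite dvdzE /= Euclid_dvdX //.
by rewrite dvdn_prime2 // => /andP[].
Qed.

Lemma locq_S p q k : prime p -> prime q -> p != q ->
  (q ^ k %| 24)%N -> ((q ^ k) ^ 2 %| N)%N -> locq p 0 (logn p N) (S_cl R N (q ^ k)).
Proof.
move=> p_pr q_pr pq v24 vN; have [g] := S_clX 1 v24 vN.
rewrite expg1 => Sg Eg; exists g => //.
exists (q ^ k)%:R%R, (q ^ k)%:Z%R, 1%R, 0%R, (q ^ k)%:Z%R; split.
  rewrite mulr0 subr0 -PoszM dvdzE /= -expnD.
  by apply: contra pq; rewrite Euclid_dvdX // dvdn_prime2 // => /andP[].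
have q0 : ((q ^ k)%:R != 0 :> R)%R by exact: prime_expR_neq0.
by rewrite Eg scale_mx2 divr1 !mulr0 !mulr1 mul1r divff //.
Qed.

Section Prime.
Variables (p mu nu : nat).
Hypothesis p_pr : prime p.
Let n := logn p N.
Hypothesis nE : n = (2 * mu + nu)%N.
Hypothesis muE : mu = minn (logn p 24) (n %/ 2).
Let w := w_cl R N (p ^ n).
Let s := S_cl R N (p ^ mu).

Lemma shift_dvd24 : (p ^ mu %| 24)%N.
Proof. by rewrite pfactor_dvdn // muE geq_minl. Qed.

Lemma shift_sqr_dvd : ((p ^ mu) ^ 2 %| N)%N.
Proof. by rewrite -expnM pfactor_dvdn // -/n nE mulnC leq_addr. Qed.

Lemma local_generation x : exists2 y, gen [set w; s] y & locq p 0 n (y^-1 * x).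
Proof.
have [W [c0 [d0 [wW B EW]]]] := w_cl_matrix R N_gt0 p_pr.
have sg := gen_subgroup [set w; s].
have gw : gen [set w; s] w by apply: sub_gen; left.
have gs : gen [set w; s] s by apply: sub_gen; right.
elim/NQuotW: x => g.
have [y yG [h hE lh]] : exists2 y, gen [set w; s] y &
    exists2 h, pi h = y * pi g & loc p mu nu (val h).
  have [lg|lg] := Norm_loc N_gt0 p_pr nE muE B EW (Norm_valP g).
    by exists 1; [case: sg|exists g; rewrite ?mul1g].
  exists w^-1; first exact: is_subgroupV sg gw.
  exists (W^-1 * g); first by rewrite pi_NQuotM pi_NQuotV -wW.
  by rewrite gmulfM gmulfV.
have [z zG [k kE [r [a [b [c [d [E D dmu]]]]]]]] : exists2 z, gen [set w; s] z &
    exists2 k, pi k = z * pi g & exists (r : R) (a b c d : int),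
    [/\ (r *: (val k : 'M_2) = mx2 a%:~R (b%:~R / (p ^ mu)%:R)
          ((p ^ (mu + nu))%:Z * c)%:~R d%:~R)%R,
        ~~ (p %| (a * d - (p ^ nu)%:Z * b * c)%R)%Z & ~~ (p %| d)%Z \/ mu = 0%N].
  have [r [a [b [c [d [D E]]]]]] := lh.
  (* Clearing b requires d prime to p, unless mu = 0. If p divides d and mu > 0, the determinant
     forces nu = 0 and b prime to p; a further factor w then moves b, up to a unit modulo p, into
     the lower right entry. *)
  have [pd|pd] := boolP (p %| d)%Z; last first.
    by exists y => //; exists h => //; exists r, a, b, c, d; split=> //; left.
  have [mu0|mu_gt0] := posnP mu.
    by exists y => //; exists h => //; exists r, a, b, c, d; split=> //; right.
  have nu0 : nu = 0%N.
    have [//|nu_gt0] := posnP nu; move: D; rewrite rpredB //.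
      by rewrite dvdz_mull.
    by rewrite -mulrA dvdz_mulr // dvdzE /= dvdn_exp.
  have pb : ~~ (p %| b)%Z.
    apply: contra D => pb; rewrite nu0 expn0 mul1r.
    by apply: rpredB; [exact: dvdz_mull|exact: dvdz_mulr].
  exists (w * y); first exact: is_subgroupM sg gw yG.
  exists (W * h); first by rewrite pi_NQuotM hE -wW mulgA.
  pose e : R := Num.sqrt (p ^ n)%:R.
  have e0 : (e != 0)%R by rewrite lt0r_neq0 // sqrtr_gt0 ltr0n expn_gt0 prime_gt0.
  have uR := @prime_expR_neq0 R p p_pr mu.
  have [NE cM] := pfactor_cofactor N_gt0 p_pr.
  set M := (N %/ _)%N in NE cM B.
  have nmm : (p ^ n = p ^ mu * p ^ mu)%N by rewrite nE nu0 addn0 mul2n -addnn expnD.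
  have EW' : ((e / (p ^ mu)%:R) *: (val W : 'M_2) = mx2 (p ^ mu)%:Z%:~R
      (1%:~R / (p ^ mu)%:R) ((p ^ (mu + nu))%:Z * (M%:Z * c0))%:~R
      ((p ^ mu)%:Z * d0)%:~R)%R.
    have NZ : (N%:Z = (p ^ mu)%:Z * (p ^ mu)%:Z * M%:Z)%R.
      by rewrite {1}NE -/n nmm !PoszM.
    rewrite EW scalerA [X in (X *: _)%R]mulrAC divff // mul1r scale_mx2 nu0 addn0.
    rewrite -/n nmm NZ.
    by congr (mx2 _ _ _ _); rewrite ?PoszM ?rmorphM /= ?natrM -?pmulrn ?rmorphM /=; field.
  have BW : ((p ^ mu)%:Z * ((p ^ mu)%:Z * d0) - (p ^ nu)%:Z * 1 * (M%:Z * c0) = 1)%R.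
    by rewrite -[RHS]B -/n nmm PoszM nu0; ring.
  exists (e / (p ^ mu)%:R * r)%R; rewrite gmulfM; do 4!eexists; split.
  - exact: scaled_loc_mul EW' E.
  - set A := (X in X \notin _).
    suff -> : A = (((p ^ mu)%:Z * ((p ^ mu)%:Z * d0) - (p ^ nu)%:Z * 1 * (M%:Z * c0)) *
        (a * d - (p ^ nu)%:Z * b * c))%R by rewrite BW mul1r.
    by rewrite /A; ring.
  - left; apply: contra pb => pd'.
    have : (p %| ((p ^ nu)%:Z * (M%:Z * c0) * b)%R)%Z.
      have -> : ((p ^ nu)%:Z * (M%:Z * c0) * b = ((p ^ nu)%:Z * (M%:Z * c0) * b +
        (p ^ mu)%:Z * d0 * d) - (p ^ mu)%:Z * d0 * d)%R by ring.
      by apply: rpredB => //; exact: dvdz_mull.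
    rewrite Euclid_dvdzM // => /orP[pM|//]; exfalso; move: (prime_gt1 p_pr).
    have : (p %| ((p ^ mu)%:Z * ((p ^ mu)%:Z * d0) - (p ^ nu)%:Z * 1 * (M%:Z * c0))%R)%Z.
      rewrite mulr1; apply: rpredB pM; apply: dvdz_mulr.
      by rewrite dvdzE /= dvdn_exp.
    by rewrite BW dvdz1 absz_nat => /eqP ->.
have [i [l H]] := loc_reduce N_gt0 p_pr nE B EW E D dmu.
have [Si SiE ESi] := S_clX i shift_dvd24 shift_sqr_dvd.
have [Sl SlE ESl] := S_clX l shift_dvd24 shift_sqr_dvd.
exists (w * s ^+ l * w^-1 * (s ^+ i * z))^-1.
  by do !(apply: (is_subgroupM sg) || apply: (is_subgroupV sg) || apply: (is_subgroupX _ sg)) => //.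
rewrite invgK; exists (W * Sl * W^-1 * (Si * k)).
  by rewrite !pi_NQuotM pi_NQuotV -SlE -SiE -wW kE !mulgA.
by rewrite !gmulfM gmulfV; exact: H.
Qed.

End Prime.

Definition level p := minn (logn p 24) (logn p N %/ 2).

Definition local_group p : set Q :=
  gen [set w_cl R N (p ^ logn p N); S_cl R N (p ^ level p)].

Lemma level_le p : (2 * level p <= logn p N)%N.
Proof.
by rewrite mulnC (leq_trans _ (leq_trunc_div _ 2)) // leq_mul2r geq_minr.
Qed.

Lemma local_group_locq p q x : prime p -> prime q -> p != q ->
  local_group q x -> locq p 0 (logn p N) x.
Proof.
move=> p_pr q_pr pq; have nE := esym (subnKC (level_le q)).
apply: (gen_sub (locq_subgroup 0 (logn p N) p_pr)) => _ [->|->].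
  exact: locq_w.
apply: locq_S => //; first exact: shift_dvd24.
exact: shift_sqr_dvd nE.
Qed.

(** The primes are peeled off from the left. A factor chosen for another prime lies in the
    localization at p and so preserves the condition already reached there; this allows successive
    choices although the subgroups need not commute. *)
Lemma local_decomposition (ps : seq nat) : uniq ps -> all prime ps ->
  forall x, exists g : nat -> Q, (forall p, p \in ps -> local_group p (g p)) /\
    forall p, p \in ps -> locq p 0 (logn p N) ((\prod_(q <- ps) g q)^-1 * x).
Proof.
elim: ps => [_ _ x|p ps IH /= /andP[pps ups] /andP[p_pr psp] x].
  by exists (fun=> 1); split.
have nE := esym (subnKC (level_le p)).
have [y yG ly] := local_generation p_pr nE (erefl _) x.
have [g [gG lg]] := IH ups psp (y^-1 * x).
have neq q : q \in ps -> q == p = false.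
  by move=> qps; apply: contraNF pps => /eqP <-.
exists (fun q => if q == p then y else g q).
have -> : \prod_(q <- p :: ps) (if q == p then y else g q) = y * \prod_(q <- ps) g q.
  rewrite big_cons eqxx; congr (_ * _); rewrite !big_seq.
  by apply: eq_bigr => q /neq ->.
split=> q; rewrite inE => /orP[/eqP->|qps]; rewrite ?eqxx ?(neq _ qps) //.
- exact: gG.
- rewrite invgM -mulgA; apply: is_subgroupM (locq_subgroup _ _ p_pr) _ ly.
  apply: is_subgroupV (locq_subgroup _ _ p_pr) _.
  rewrite big_seq; elim/big_rec: _ => [|q' z q'ps lz].
    by case: (locq_subgroup 0 (logn p N) p_pr).
  apply: is_subgroupM (locq_subgroup _ _ p_pr) _ lz.
  apply: local_group_locq (gG _ q'ps) => //; first exact: (allP psp).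
  by rewrite eq_sym neq.
- by rewrite invgM -mulgA; exact: lg.
Qed.

End Quotient.

Arguments local_group R N p : clear implicits.

(** * Reduction modulo p^mu *)

Section ModTuples.
Variables (u P : nat).

Definition quad := (nat * nat * nat * nat)%type.

Definition qone : quad := (1, 0, 0, 1).
(** A tuple stands for [[a, b], [P c, d]], with c itself known modulo u and P standing for p^nu.
    Natural numbers let the finite tests be evaluated. *)
Definition qmul (x y : quad) : quad :=
  let: (a, b, c, d) := x in let: (a', b', c', d') := y in
  ((a * a' + P * (b * c')) %% u, (a * b' + b * d') %% u,
   (c * a' + d * c') %% u, (P * (c * b') + d * d') %% u).
(** Reducing b and c first keeps the truncated subtraction exact. *)
Definition qinv (x : quad) : quad :=
  let: (a, b, c, d) := x in (d, u - b %% u, u - c %% u, a).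
Definition qtriv (x : quad) : bool :=
  let: (a, b, c, d) := x in (u %| b) && (u %| c).
Definition qeq (x y : quad) := qtriv (qmul (qinv x) y).

End ModTuples.

Section Reduction.
Local Open Scope ring_scope.
Variables (R : realType) (N : nat).
Hypothesis N_gt0 : (0 < N)%N.
Variables (p mu nu : nat).
Hypothesis p_pr : prime p.
Let n := logn p N.
Hypothesis nE : n = (2 * mu + nu)%N.
Hypothesis muE : mu = level N p.
Let M := (N %/ p ^ n)%N.
Let u := (p ^ mu)%N.
Variable P : nat.
Hypothesis PE : P = p ^ nu %[mod u].
Local Notation Q := (NQuot R N).
Local Notation pi := (\pi_(NQuot R N)%qT).
Local Notation qmul := (qmul u P).
Local Notation w := (w_cl R N (p ^ n)).
Local Notation s := (S_cl R N u).

Definition cong (x : int) (a : nat) := (u%:Z %| x - a%:Z)%Z.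

Lemma congD x y a b : cong x a -> cong y b -> cong (x + y) (a + b).
Proof.
move=> xa yb; rewrite /cong.
have -> : x + y - (a + b)%N%:Z = (x - a%:Z) + (y - b%:Z) by rewrite PoszD; ring.
exact: rpredD.
Qed.

Lemma congM x y a b : cong x a -> cong y b -> cong (x * y) (a * b).
Proof.
move=> xa yb; rewrite /cong.
have -> : x * y - (a * b)%N%:Z = (x - a%:Z) * y + a%:Z * (y - b%:Z).
  by rewrite PoszM; ring.
by apply: rpredD; [exact: dvdz_mulr|exact: dvdz_mull].
Qed.

Lemma congN x a : cong x a -> cong (- x) (u - a %% u).
Proof.
move=> xa; rewrite /cong.
have u0 : (0 < u)%N by rewrite expn_gt0 prime_gt0.
have -> : - x - (u - a %% u)%N%:Z = - (x - a%:Z) - (a %/ u).+1%:Z * u%:Z.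
  rewrite -subzn; last by rewrite ltnW // ltn_mod.
  by rewrite {2}(divn_eq a u) PoszD PoszM -[(a %/ u).+1]addn1 PoszD; ring.
by apply: rpredB; [rewrite rpredN|exact: dvdz_mull].
Qed.

Lemma cong_mod x a : cong x a -> cong x (a %% u).
Proof.
move=> xa; rewrite /cong.
have -> : x - (a %% u)%N%:Z = (x - a%:Z) + (a %/ u)%N%:Z * u%:Z.
  by rewrite {2}(divn_eq a u) PoszD PoszM; ring.
by apply: rpredD => //; exact: dvdz_mull.
Qed.

Lemma cong_dvd x a : cong x a -> (u %| x)%Z = (u %| a)%N.
Proof.
move=> xa; have -> : (u %| a)%N = (u %| a%:Z)%Z by rewrite dvdzE.
by rewrite -[x](subrK a%:Z) rpredDl.
Qed.

Lemma congP : cong (p ^ nu)%:Z P.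
Proof. by rewrite /cong -eqz_mod_dvd !modz_nat PE. Qed.

Let Meq : (N = p ^ n * M)%N. Proof. by have [] := pfactor_cofactor N_gt0 p_pr. Qed.
Let Mcop : coprime p M. Proof. by have [] := pfactor_cofactor N_gt0 p_pr. Qed.

(* g is in the conjugate of SL_2(Z) (for nu = 0) or Gamma_0(p^nu) by
   diag(u, 1); only the prime-to-p part M of N is kept in the entry C. *)
Definition reduces (x : Q) (t : quad) : Prop :=
  let: (a, b, c, d) := t in
  exists2 g : Norm R N, pi g = x & exists A B C D : int,
  (val g : 'M_2) = mx2 A%:~R (B%:~R / u%:R) ((p ^ (mu + nu))%:Z * (M%:Z * C))%:~R D%:~R
  /\ [/\ cong A a, cong B b, cong (M%:Z * C) c & cong D d].

Lemma reduces_one : reduces 1%g qone.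
Proof.
exists 1%g => //; exists 1, 0, 0, 1; rewrite mul0r !mulr0; split.
  exact: scalar_mx2.
by rewrite /cong !subrr.
Qed.

Lemma reduces_mul x y t t' : reduces x t -> reduces y t' -> reduces (x * y)%g (qmul t t').
Proof.
case: t => [[[a b] c] d]; case: t' => [[[a' b'] c'] d'].
move=> [g <- [A [B [C [D [Eg [cA cB cC cD]]]]]]].
move=> [h <- [A' [B' [C' [D' [Eh [cA' cB' cC' cD']]]]]]].
exists (g * h)%g; first by rewrite pi_NQuotM.
exists (A * A' + (p ^ nu)%:Z * (B * (M%:Z * C'))), (A * B' + B * D').
exists (C * A' + D * C'), ((p ^ nu)%:Z * (M%:Z * C * B') + D * D'); split.
  have u0 : (u%:R != 0 :> R) by exact: prime_expR_neq0.
  rewrite gmulfM SL2_mulE Eg Eh mul_mx2 expnD -/u.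
  by congr (mx2 _ _ _ _); rewrite !(rmorphD, rmorphM) /= -?pmulrn; field.
split; apply: cong_mod; rewrite ?mulrDr.
- by apply: congD; [|apply: (congM congP)]; apply: congM.
- by apply: congD; apply: congM.
- rewrite mulrA mulrCA; by apply: congD; apply: congM.
- by apply: congD; [apply: (congM congP)|]; apply: congM.
Qed.

Lemma reduces_inv x t : reduces x t -> reduces x^-1%g (qinv u t).
Proof.
case: t => [[[a b] c] d] [g <- [A [B [C [D [Eg [cA cB cC cD]]]]]]].
exists g^-1%g; first by rewrite pi_NQuotV.
exists D, (- B), (- C), A; split.
  rewrite gmulfV (SL2_invE Eg).
  by congr (mx2 _ _ _ _); rewrite ?mulrN rmorphN ?mulNr.
by rewrite mulrN; split=> //; apply: congN.
Qed.

Lemma reduces_eq1 x t : reduces x t -> x = 1%g <-> qtriv u t.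
Proof.
case: t => [[[a b] c] d] [g <- [A [B [C [D [Eg [cA cB cC cD]]]]]]].
have uR : (u%:R != 0 :> R) by exact: prime_expR_neq0.
have -> : pi g = 1%g <-> val g \in Gamma0 N.
  split=> [/eqP|gG]; last apply/esym/eqP.
    by rewrite eq_sym NQuot_eq invg1 mul1g.
  by rewrite NQuot_eq invg1 mul1g.
(* The tuple records M C; as p does not divide M, this vanishes modulo u exactly when C does. *)
have CM : (u %| C)%Z = (u %| M%:Z * C)%Z.
  by rewrite Gauss_dvdzr // coprimezE /= coprimeXl.
rewrite /= -(cong_dvd cB) -(cong_dvd cC) -CM.
have pp : (p ^ n = p ^ (mu + nu) * u)%N by rewrite -expnD nE; congr expn; move: mu nu; clear; lia.
split=> [/Gamma0P[a' [b' [c' [d']]]]|/andP[/dvdzP[b' BE] /dvdzP[c' CE]]].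
  rewrite Eg => E; have [_ eb ec _] := mx2_inj E; apply/andP; split.
    have -> : B = b' * u%:Z; last exact: dvdz_mull.
    apply: (@intr_inj R); rewrite rmorphM /= -eb -pmulrn divfK //.
  have -> : C = c' * u%:Z; last exact: dvdz_mull.
  have NZ : N%:Z != 0 by rewrite -lt0n.
  have H : ((p ^ (mu + nu))%:Z * (M%:Z * C) = N%:Z * c') by apply: (@intr_inj R).
  have K0 : (p ^ (mu + nu))%:Z * M%:Z != 0.
    by apply: contra NZ => /eqP K0; rewrite Meq pp !PoszM mulrAC K0 mul0r.
  by apply: (mulfI K0); rewrite -mulrA H {1}Meq pp !PoszM; ring.
apply/Gamma0P; exists A, b', c', D; rewrite Eg; congr (mx2 _ _ _ _).
  by rewrite BE rmorphM /= -pmulrn mulfK.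
by rewrite CE Meq pp !PoszM; congr (_%:~R); ring.
Qed.

Lemma reduces_eq x y t t' : reduces x t -> reduces y t' -> x = y <-> qeq u P t t'.
Proof.
move=> rx ry; have := reduces_eq1 (reduces_mul (reduces_inv rx) ry).
rewrite -/(qeq u P t t') => <-; split=> [->|/mulg1_eq]; first by rewrite mulVg.
by rewrite invgK.
Qed.

Lemma reduces_prod (I : Type) (y : I -> Q) (t : I -> quad) (l : seq I) :
  (forall i, reduces (y i) (t i)) ->
  reduces (\prod_(i <- l) y i)%g (foldr (fun i q => qmul (t i) q) qone l).
Proof.
move=> yt; elim: l => [|i l IH]; first by rewrite big_nil; exact: reduces_one.
by rewrite big_cons /=; exact: reduces_mul.
Qed.

Lemma reduces_shift i : reduces (s ^+ i)%g (1, i, 0, 1)%N.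
Proof.
have [g -> Eg] := S_clX R i (shift_dvd24 p_pr muE) (shift_sqr_dvd N_gt0 p_pr nE).
exists g => //; exists 1, i%:Z, 0, 1; rewrite Eg !mulr0 -pmulrn.
by split; rewrite // /cong !subrr.
Qed.

Lemma shift_order : (s ^+ u = 1)%g.
Proof. by apply/(reduces_eq1 (reduces_shift u)); rewrite /= dvdnn dvdn0. Qed.

(** The inverse of an Atkin-Lehner matrix is one for the same divisor, and all of these share one
    class. *)
Lemma w_clV : (w^-1 = w)%g.
Proof.
have m_gt0 : (0 < p ^ n)%N by rewrite expn_gt0 prime_gt0.
have mN : (p ^ n %| N)%N := pfactor_dvdnn p N.
have cop : coprime (p ^ n) (N %/ p ^ n) by rewrite coprimeXl.
have : [set w]%classic w by [].
rewrite -(w_clP R m_gt0 mN cop) => -[W ALW WE].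
have : @AL_class R N (p ^ n) w^-1%g.
  exists W^-1%g; last by rewrite pi_NQuotV WE.
  suff : AL_form N (p ^ n) (val W^-1%g) by [].
  by rewrite gmulfV; exact: AL_formV.
by rewrite (w_clP R m_gt0 mN cop).
Qed.

Lemma w_cl_sqr : (w ^+ 2 = 1)%g.
Proof. by rewrite expg2 -{1}w_clV mulVg. Qed.

(** This is available for every nu, whereas w alone has no reduction when nu > 0. The factor u - 1
    stands for -1, the residue of M c0. *)
Lemma reduces_conj_shift l : reduces (w * s ^+ l * w)%g (1, 0, (u - 1) * l, 1)%N.
Proof.
have [W [c0 [d0 [wW B EW]]]] := w_cl_matrix R N_gt0 p_pr.
have [Sl SlE ESl] := S_clX R l (shift_dvd24 p_pr muE) (shift_sqr_dvd N_gt0 p_pr nE).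
pose X := (p ^ (mu + nu))%:Z * M%:Z * c0.
have ET := conj_shift_matrix N_gt0 p_pr nE (erefl X) B EW ESl.
exists (W * Sl * W^-1)%g.
  by rewrite !pi_NQuotM pi_NQuotV -SlE -wW w_clV.
have u0 : (u%:R != 0 :> R) by exact: prime_expR_neq0.
exists (1 - l%:Z * X), (l%:Z * (p ^ (mu + nu))%:Z * u%:Z), (- l%:Z * M%:Z * (c0 * c0)).
exists (1 + l%:Z * X); split.
  rewrite !gmulfM gmulfV ET -/M.
  congr (mx2 _ _ _ _); rewrite ?(rmorphD, rmorphB, rmorphM, rmorphN, rmorph1) /=
    -?pmulrn ?(mulfK u0) //; ring.
have uX : (u%:Z %| X)%Z by rewrite /X expnD PoszM -!mulrA dvdz_mulr.
split; rewrite /cong.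
- by rewrite addrAC subrr add0r rpredN dvdz_mull.
- by rewrite subr0 dvdz_mull.
- have un : (u%:Z %| (p ^ n)%:Z)%Z.
    by rewrite dvdzE /= dvdn_exp2l // nE mul2n -addnn -addnA leq_addr.
  have u1 : (0 < u)%N by rewrite expn_gt0 prime_gt0.
  have KE : M%:Z * c0 = (p ^ n)%:Z * d0 - 1 by rewrite -[1 in RHS]B subKr.
  have -> : M%:Z * (- l%:Z * M%:Z * (c0 * c0)) = - l%:Z * (M%:Z * c0) * (M%:Z * c0).
    by ring.
  rewrite KE PoszM -subzn //; move: (p ^ n)%:Z un => m um.
  have -> : - l%:Z * (m * d0 - 1) * (m * d0 - 1) - (u%:Z - 1) * l%:Z =
    (2 * l%:Z * d0 - l%:Z * m * d0 * d0) * m - l%:Z * u%:Z by ring.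
  by apply: rpredB; apply: dvdz_mull.
- by rewrite addrAC subrr add0r dvdz_mull.
Qed.

(** For nu = 0 the square root of p^n is the integer u, so w becomes the Weyl element [[0, 1],
    [-1, 0]] modulo u, whatever N is. *)
Lemma reduces_w : nu = 0%N -> reduces w (0, 1, u - 1, 0)%N.
Proof.
move=> nu0; have [W [c0 [d0 [wW B EW]]]] := w_cl_matrix R N_gt0 p_pr.
have nu2 : (p ^ n = u * u)%N by rewrite /u -expnD nE nu0; congr expn; move: mu nu; clear; lia.
have u0 : (u%:R != 0 :> R) by exact: prime_expR_neq0.
have u1 : (0 < u)%N by rewrite expn_gt0 prime_gt0.
exists W => //; exists u%:Z, 1, c0, (u%:Z * d0); split.
  rewrite EW -/n nu2 natrM -expr2 sqrtr_sqr ger0_norm ?ler0n // scale_mx2 nu0 addn0 -/u.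
  rewrite [N%:Z](_ : _ = u%:Z * u%:Z * M%:Z); last by rewrite {1}Meq nu2 !PoszM.
  by congr (mx2 _ _ _ _); rewrite ?PoszM ?rmorphM /= -?pmulrn ?rmorphM /= -?pmulrn; field.
split; rewrite /cong ?subr0 ?subrr ?dvdz0 ?dvdz_mulr //.
have -> : M%:Z * c0 - (u - 1)%N%:Z = ((p ^ n)%:Z * d0 - ((p ^ n)%:Z * d0 - M%:Z * c0))
    + 1 - u%:Z by rewrite -subzn //; ring.
rewrite B subrK nu2 PoszM -mulrA.
by apply: rpredB => //; exact: dvdz_mulr.
Qed.

(** In every multiple of W the upper row has ratio p^n, so p would divide a, and with the factor
    p^nu also the determinant. This separates words with oddly many w from those with evenly
    many. *)
Lemma w_notin_locq : (0 < nu)%N -> ~ locq p mu nu w.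
Proof.
move=> nu_gt0; have [W [c0 [d0 [-> B EW]]]] := w_cl_matrix R N_gt0 p_pr.
move/(locqP N_gt0 p_pr nE) => [r [a [b [c [d [D]]]]]].
rewrite EW scalerA scale_mx2 => E; have [ea eb _ _] := mx2_inj E.
have u0 : (u%:R != 0 :> R) by exact: prime_expR_neq0.
have aE : a = b * (p ^ (mu + nu))%:Z.
  apply: (@intr_inj R); rewrite rmorphM /= -ea -/n -pmulrn.
  move: eb; rewrite mulr1 => ->.
  have -> : (p ^ n = u * p ^ (mu + nu))%N by rewrite -expnD nE; congr expn; move: mu nu; clear; lia.
  by rewrite natrM mulrA divfK.
move/negP: D; apply; rewrite aE; apply: rpredB.
  rewrite mulrAC; apply: dvdz_mull.
  by rewrite dvdzE /= dvdn_exp // addn_gt0 nu_gt0 orbT.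
by rewrite -mulrA; apply: dvdz_mulr; rewrite dvdzE /= dvdn_exp.
Qed.

End Reduction.

Section Relations.
Local Open Scope group_scope.
Local Open Scope classical_set_scope.
Variables (T : groupType) (I : Type) (y : I -> T).

Lemma gevalX (t : gword I) k : geval y (t ^+ k) = geval y t ^+ k.
Proof. by elim: k => [|[|k] IH] //; rewrite !expgSS /= IH. Qed.

Lemma satisfies3 (t1 u1 t2 u2 t3 u3 : gword I) :
  satisfies y [set (t1, u1); (t2, u2); (t3, u3)] <->
  [/\ geval y t1 = geval y u1, geval y t2 = geval y u2 & geval y t3 = geval y u3].
Proof.
split=> [H|[e1 e2 e3] t u]; last by move=> [[]|] [-> ->].
by split; apply: H; [left; left|left; right|right].
Qed.

End Relations.

Definition word_quad u P (gt : bool -> quad) (l : seq bool) : quad :=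
  foldr (fun i q => qmul u P (gt i) q) qone l.
Definition word_quads_distinct u P gt (L : seq (seq bool)) : bool :=
  all (fun l => all (fun l' =>
    qeq u P (word_quad u P gt l) (word_quad u P gt l') ==> (l == l')) L) L.
Definition word_quads_closed u P gt (L : seq (seq bool)) : bool :=
  all (fun l => all (fun b => has (fun l' =>
    qeq u P (word_quad u P gt (rcons l b)) (word_quad u P gt l')) L) [:: false; true]) L.
Definition shift_conj_distinct u : bool :=
  let q ij := qmul u 0 (1, ij.1, 0, 1) (1, 0, (u - 1) * ij.2, 1) in
  let L := [seq (i, j) | i <- iota 0 u, j <- iota 0 u] in
  all (fun ij => all (fun ij' => qeq u 0 (q ij) (q ij') ==> (ij == ij')) L) L.

(** * Relations, normal forms and orders read off from reductions *)

Section Local.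
Local Open Scope group_scope.
Local Open Scope classical_set_scope.
Variables (R : realType) (N : nat).
Hypothesis N_gt0 : (0 < N)%N.
Variables (p mu nu : nat).
Hypothesis p_pr : prime p.
Let n := logn p N.
Hypothesis nE : n = (2 * mu + nu)%N.
Hypothesis muE : mu = level N p.
Let u := (p ^ mu)%N.
Local Notation Q := (NQuot R N).
Local Notation w := (w_cl R N (p ^ n)).
Local Notation s := (S_cl R N u).
Let y (b : bool) : Q := if b then s else w.

Let u_gt0 : (0 < u)%N. Proof. by rewrite expn_gt0 prime_gt0. Qed.
Let w2 : w ^+ 2 = 1 := w_cl_sqr R N_gt0 p_pr.
Let su : s ^+ u = 1 := shift_order R N_gt0 p_pr nE muE.

Lemma genE : gen [set w; s] = gen (range y).
Proof. by rewrite range_bool. Qed.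

Section ExactLevel.
Hypothesis nu0 : nu = 0%N.

Definition gen_quad (b : bool) : quad :=
  if b then (1, 1, 0, 1)%N else (0, 1, u - 1, 0)%N.

Let PE : 1 = p ^ nu %[mod u]. Proof. by rewrite nu0. Qed.

Lemma word_quadP l : reduces p mu nu (\prod_(b <- l) y b) (word_quad u 1 gen_quad l).
Proof.
apply: (reduces_prod p_pr PE); case; last exact: reduces_w.
by have := reduces_shift R N_gt0 p_pr nE muE 1; rewrite expg1.
Qed.

Lemma word_prod_eq l l' : \prod_(b <- l) y b = \prod_(b <- l') y b <->
  qeq u 1 (word_quad u 1 gen_quad l) (word_quad u 1 gen_quad l').
Proof. exact: (reduces_eq N_gt0 p_pr nE PE (word_quadP l) (word_quadP l')). Qed.

Lemma word_prod_inj L : word_quads_distinct u 1 gen_quad L ->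
  {in L &, injective (fun l => \prod_(b <- l) y b)}.
Proof.
move=> /allP H l l' Ll Ll' /word_prod_eq E.
by have /allP/(_ _ Ll') := H _ Ll; rewrite E => /eqP.
Qed.

(** This serves u = 8, where the relations may not suffice: that [L] exhausts the group is checked
    on reductions instead of being derived. *)
Lemma word_prod_closed L : [::] \in L -> word_quads_closed u 1 gen_quad L ->
  forall t, exists2 l, l \in L & geval y t = \prod_(b <- l) y b.
Proof.
move=> L0 /allP H t; pose A := [set \prod_(b <- l) y b | l in [set` L]].
have [|b|x b [l Ll <-]|l Ll <-] := @geval_mul_closed _ _ y A _ _ _ t.
- by exists [::]; rewrite ?big_nil.
- by case: b; [exists u.-1; rewrite prednK|exists 1%N].
- have /allP/(_ b) := H _ Ll; rewrite !inE; case: b => // /(_ isT)/hasP[l' Ll'];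
  by move/word_prod_eq => E; exists l'; rewrite // -E -cats1 big_cat big_seq1.
- by exists l.
Qed.

Lemma ws_cube : qtriv u (word_quad u 1 gen_quad [:: false; true; false; true; false; true]) ->
  (w * s) ^+ 3 = 1.
Proof.
move=> H; have <- := (proj2 (reduces_eq1 N_gt0 p_pr nE (word_quadP _)) H).
by rewrite !big_cons big_nil /= mulg1 expgS expg2 !mulgA.
Qed.

Let rels3 (w s : gword bool) := [set (w ^+ 2, 1 : gword bool); (s ^+ u, 1 : gword bool);
   ((w * s) ^+ 3, 1 : gword bool)].

Lemma presented_exact L :
  (forall (U : groupType) (y : bool -> U), y false ^+ 2 = 1 -> y true ^+ u = 1 ->
     (y false * y true) ^+ 3 = 1 ->
     forall t, exists2 l, l \in L & geval y t = \prod_(i <- l) y i) ->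
  (w * s) ^+ 3 = 1 -> word_quads_distinct u 1 gen_quad L -> uniq L ->
  presented2 w s rels3 /\ (gen [set w; s] #= `I_(size L))%card.
Proof.
move=> nf ws3 dL uL; have inj := word_prod_inj dL; split; last first.
  by rewrite genE; apply: card_gen_normal_forms => //; exact: nf.
apply: presented_normal_forms inj.
  by apply/satisfies3; rewrite !gevalX /= w2 su ws3.
by move=> U y' /satisfies3; rewrite !gevalX /= => -[]; exact: nf.
Qed.

End ExactLevel.

Lemma reduces_locq (x : Q) t : reduces p mu nu x t -> locq p mu nu x.
Proof.
case: t => [[[a b] c] d] [g gx [A [B [C [D [Eg _]]]]]]; exists g => //.
exists 1%R, A, B, ((N %/ p ^ n)%:Z * C)%R, D; split; last by rewrite scale1r.
have uR : ((p ^ mu)%:R != 0 :> R)%R by exact: prime_expR_neq0.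
have := SL2_det (val g); rewrite Eg det_mx2.
suff -> : (A%:~R * D%:~R - B%:~R / (p ^ mu)%:R *
   ((p ^ (mu + nu))%:Z * ((N %/ p ^ logn p N)%:Z * C))%:~R =
   (A * D - (p ^ nu)%:Z * B * ((N %/ p ^ n)%:Z * C))%:~R :> R)%R.
  rewrite -[1%R]/(1%:~R)%R eqr_int => /eqP ->; rewrite dvdz1 absz_nat.
  by rewrite neq_ltn prime_gt1 ?orbT.
rewrite expnD ?PoszM !(rmorphD, rmorphB, rmorphN, rmorphM) /= -?pmulrn.
by rewrite -/n; field.
Qed.

Section Twisted.
Variable P : nat.
Hypothesis PE : P = p ^ nu %[mod u].

Lemma shift_conjP i j : reduces p mu nu (s ^+ i * (w * s ^+ j * w))
  (qmul u P (1, i, 0, 1)%N (1, 0, (u - 1) * j, 1)%N).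
Proof.
apply: (reduces_mul p_pr PE); first exact: reduces_shift.
exact: reduces_conj_shift.
Qed.

(** A relator with evenly many w is cut into blocks s^i (w s^j w), each of which has a known tuple
    even when nu > 0. *)
Lemma relation_from_quads (l : seq (nat * nat)) :
  qtriv u (foldr (fun ij => qmul u P (qmul u P (1, ij.1, 0, 1)%N (1, 0, (u - 1) * ij.2, 1)%N))
     qone l) ->
  \prod_(ij <- l) (s ^+ ij.1 * (w * s ^+ ij.2 * w)) = 1.
Proof.
move=> H; apply: (proj2 (reduces_eq1 N_gt0 p_pr nE _) H).
by apply: (reduces_prod p_pr PE) => ij; exact: shift_conjP.
Qed.

(** The quotient of the two products has both off-diagonal entries congruent to P, so the test
    succeeds exactly when u divides P. *)
Lemma commute_shift_conj :
  (let q := (1, 1, 0, 1)%N in let q' := (1, 0, u - 1, 1)%N in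
   qeq u P (qmul u P q q') (qmul u P q' q)) -> commute s (w * s * w).
Proof.
move=> H; have rs := reduces_shift R N_gt0 p_pr nE muE 1.
have rt := reduces_conj_shift R N_gt0 p_pr nE muE 1.
rewrite expg1 in rs rt; rewrite muln1 in rt.
have [_ E] := reduces_eq N_gt0 p_pr nE PE (reduces_mul p_pr PE rs rt)
  (reduces_mul p_pr PE rt rs).
exact: E.
Qed.

End Twisted.

Section Commuting.
Hypothesis nu_gt0 : (0 < nu)%N.
Hypothesis PE : 0 = p ^ nu %[mod u].

Let ww : w * w = 1. Proof. by rewrite -expg2. Qed.

Let prod1 i j : \prod_(b <- nseq i true ++ false :: nseq j true) y b =
  s ^+ i * (w * s ^+ j * w) * w.
Proof.
rewrite big_cat big_cons /= !big_nseq !iter_mulg_1 /= !mulgA.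
by rewrite -[RHS]mulgA ww mulg1.
Qed.

Let prod2 i j : \prod_(b <- nseq i true ++ false :: rcons (nseq j true) false) y b =
  s ^+ i * (w * s ^+ j * w).
Proof.
rewrite -cats1 big_cat big_cons /= big_cat big_cons big_nil /=.
by rewrite !big_nseq !iter_mulg_1 mulg1 !mulgA.
Qed.

(** Values of [words2] lie in the localization and those of [words1] in its translate by w, which is
    disjoint from it. Within each list the tuples tell the exponents apart. *)
Lemma words12_inj : shift_conj_distinct u ->
  {in words1 u ++ words2 u &, injective (fun l => \prod_(b <- l) y b)}.
Proof.
move=> /allP H.
have inj i j i' j' : (i, j) \in [seq (i, j) | i <- iota 0 u, j <- iota 0 u] ->
    (i', j') \in [seq (i, j) | i <- iota 0 u, j <- iota 0 u] ->
    s ^+ i * (w * s ^+ j * w) = s ^+ i' * (w * s ^+ j' * w) -> (i, j) = (i', j').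
  move=> ij ij'; move/(reduces_eq N_gt0 p_pr nE PE (shift_conjP PE i j) (shift_conjP PE i' j')) => E.
  by have /allP/(_ _ ij') := H _ ij; rewrite E => /eqP.
have wx i j i' j' : s ^+ i * (w * s ^+ j * w) <> s ^+ i' * (w * s ^+ j' * w) * w.
  move=> E; apply: (@w_notin_locq R N N_gt0 p mu nu p_pr nE nu_gt0).
  have -> : w = (s ^+ i' * (w * s ^+ j' * w))^-1 * (s ^+ i * (w * s ^+ j * w)).
    by rewrite E mulKg.
  have sg := locq_subgroup R N mu nu p_pr.
  by apply: (is_subgroupM sg); [apply: (is_subgroupV sg)|]; apply: reduces_locq (shift_conjP PE _ _).
move=> l l'; rewrite !mem_cat.
move=> /orP[] /allpairsP[[i j] [/= iu ju ->]] /orP[] /allpairsP[[i' j'] [/= iu' ju' ->]];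
  rewrite ?prod1 ?prod2.
- by move=> /mulIg E; have [-> ->] := inj i j i' j' (allpairs_f pair iu ju) (allpairs_f pair iu' ju') E.
- by move=> E; case: (wx i' j' i j).
- by move=> /wx.
- by move=> E; have [-> ->] := inj i j i' j' (allpairs_f pair iu ju) (allpairs_f pair iu' ju') E.
Qed.

Lemma presented_higher rels :
  satisfies y rels -> shift_conj_distinct u -> uniq (words1 u ++ words2 u) ->
  (forall (U : groupType) (y : bool -> U), satisfies y rels ->
     [/\ y false ^+ 2 = 1, y true ^+ u = 1 & commute (y true) (y false * y true * y false)]) ->
  presented y rels /\ (gen [set w; s] #= `I_(size (words1 u ++ words2 u)))%card.
Proof.
move=> yr dist uL nf; have inj := words12_inj dist.
have nf' (U : groupType) (y' : bool -> U) : satisfies y' rels ->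
    forall t, exists2 l, l \in words1 u ++ words2 u & geval y' t = \prod_(i <- l) y' i.
  by case/nf => w2' su' c; exact: words_commute.
split; first exact: presented_normal_forms inj.
by rewrite genE; apply: card_gen_normal_forms => //; exact: nf'.
Qed.

End Commuting.

End Local.

(** * Structure of the local groups *)

(** The twelve tails represent the right cosets of the subgroup of order 8 generated by s; the two
    computations that follow certify the choice. *)
Definition words96 : seq (seq bool) :=
  [seq nseq i true ++ r | i <- iota 0 8, r <-
    let w := false in let s := true in
    [:: [::]; [:: w]; [:: w; s]; [:: w; s; w]; [:: w; s; s]; [:: w; s; s; w];
        [:: w; s; s; s]; [:: w; s; s; w; s]; [:: w; s; s; s; w]; [:: w; s; s; s; s];
        [:: w; s; s; w; s; w]; [:: w; s; s; s; s; w]]].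

Lemma words96_distinct : word_quads_distinct 8 1 (gen_quad 2 3) words96.
Proof. by vm_compute. Qed.

Lemma words96_closed : word_quads_closed 8 1 (gen_quad 2 3) words96.
Proof. by vm_compute. Qed.

Section LocalGroups.
Local Open Scope group_scope.
Local Open Scope classical_set_scope.
Variables (R : realType) (N : nat).
Hypothesis N_gt0 : (0 < N)%N.
Local Notation Q := (NQuot R N).

Lemma w_cl_1 : w_cl R N 1 = 1.
Proof.
have AL1 : @AL_class R N 1 1.
  exists 1 => //; suff : AL_form N 1 (val (1 : Norm R N)) by [].
  rewrite val1; exists 1%R, 0%R, 0%R, 1%R.
  by rewrite sqrtr1 invr1 scale1r !mulr0 mulr1 -scalar_mx2.
by move: AL1; rewrite (w_clP R) ?dvd1n ?divn1 ?coprime1n.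
Qed.

Lemma gen_pair1 (T : groupType) (x : T) : gen [set x; 1] = gen [set x].
Proof.
apply/seteqP; split; apply: gen_sub (gen_subgroup _) _.
  by move=> _ [->|->]; [exact: sub_gen|case: (gen_subgroup [set x])].
by move=> _ ->; apply: sub_gen; left.
Qed.

Lemma gen_1 (T : groupType) : gen [set (1 : T)] = [set 1].
Proof.
apply/seteqP; split; last exact: sub_gen.
apply: gen_sub => //; split=> // _ _ -> ->; exact: mulgV.
Qed.

Lemma local_group_level0 p : prime p -> level N p = 0%N ->
  local_group R N p = gen [set w_cl R N (p ^ logn p N)].
Proof.
move=> p_pr l0; rewrite /local_group l0 expn0.
have nE : logn p N = (2 * 0 + logn p N)%N by [].
have := shift_order R N_gt0 p_pr nE (esym l0).
by rewrite expn0 expg1 => ->; rewrite gen_pair1.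
Qed.

Lemma local_group_logn0 p : prime p -> logn p N = 0%N -> local_group R N p = [set 1].
Proof.
move=> p_pr n0; rewrite local_group_level0 // ?n0 ?expn0 ?w_cl_1 ?gen_1 //.
by rewrite /level n0 minn0.
Qed.

Lemma product_decomposition (x : Q) : exists g : nat -> Q,
  [/\ local_group R N 2 (g 2), local_group R N 3 (g 3),
      forall q, prime q -> (5 <= q)%N -> (q %| N)%N -> local_group R N q (g q)
    & x = g 2 * g 3 * \prod_(q <- primes N | (5 <= q)%N) g q].
Proof.
pose qs := [seq q <- primes N | (5 <= q)%N].
have memqs q : q \in qs = (5 <= q)%N && (q \in primes N) by rewrite mem_filter.
have ups : uniq [:: 2, 3 & qs].
  by rewrite /= !inE !memqs /= filter_uniq ?primes_uniq.
have pps : all prime [:: 2, 3 & qs].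
  by apply/allP => q; rewrite !inE memqs mem_primes => /or3P[/eqP->|/eqP->|/and4P[]].
have [g [gG lg]] := local_decomposition N_gt0 ups pps x.
exists g; split; try by apply: gG; rewrite !inE.
  move=> q q_pr q5 qN; apply: gG.
  by rewrite !inE memqs q5 mem_primes q_pr N_gt0 qN !orbT.
have /esym/mulg1_eq : 1 = (\prod_(q <- [:: 2, 3 & qs]) g q)^-1 * x.
  apply/esym/(locq_eq1 N_gt0) => p p_pr; have [/lg//|pps'] := boolP (p \in [:: 2, 3 & qs]).
  (* The list contains all prime divisors of N. At any other p the local group is trivial, so
     [local_generation] puts every class into the localization at p. *)
  have n0 : logn p N = 0%N.
    apply/eqP; rewrite -leqn0 leqNgt logn_gt0; apply: contra pps' => pN.
    rewrite !inE memqs pN andbT; case: p p_pr pN => [|[|[|[|[|p]]]]] //.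
  set z := _ * x; have nE : logn p N = (2 * 0 + logn p N)%N by [].
  have l0 : 0%N = minn (logn p 24) (logn p N %/ 2) by rewrite n0 minn0.
  have [y] := local_generation N_gt0 p_pr nE l0 z.
  have := local_group_logn0 p_pr n0; rewrite /local_group /level -l0 => -> ->.
  by rewrite invg1 mul1g.
by rewrite invgK => <-; rewrite !big_cons mulgA big_filter.
Qed.

Lemma w_neq1 p : prime p -> (p %| N)%N -> w_cl R N (p ^ logn p N) <> 1.
Proof.
move=> p_pr pN w1; have nE : logn p N = (2 * 0 + logn p N)%N by [].
apply: (w_notin_locq N_gt0 p_pr nE (R := R)).
  by rewrite logn_gt0 mem_primes p_pr N_gt0.
by rewrite w1; case: (locq_subgroup R N 0 (logn p N) p_pr).
Qed.

Lemma logn_24_ge5 q : prime q -> (5 <= q)%N -> logn q 24 = 0%N.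
Proof.
move=> q_pr q5; apply/eqP; rewrite -leqn0 leqNgt logn_gt0.
by rewrite (_ : primes 24 = [:: 2; 3]) // !inE; case: q q5 q_pr => [|[|[|[|]]]].
Qed.

Lemma level0_structure p : prime p -> (p %| N)%N -> level N p = 0%N ->
  [/\ local_group R N p = gen [set w_cl R N (p ^ logn p N)],
     w_cl R N (p ^ logn p N) ^+ 2 = 1 & w_cl R N (p ^ logn p N) <> 1].
Proof.
by move=> p_pr pN l0; split; [exact: local_group_level0|exact: w_cl_sqr|exact: w_neq1].
Qed.

Lemma logn1_structure p : prime p -> logn p N = 1%N ->
  [/\ local_group R N p = gen [set w_cl R N p], w_cl R N p ^+ 2 = 1
    & w_cl R N p <> 1].
Proof.
move=> p_pr n1; have := @level0_structure p p_pr; rewrite n1 expn1; apply.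
  by have : (0 < logn p N)%N by [rewrite n1]; rewrite logn_gt0 mem_primes => /and3P[].
by rewrite /level n1 minn0.
Qed.

End LocalGroups.

(** * The individual cases for the primes 3 and 2 *)

Section Structure.
Local Open Scope group_scope.
Local Open Scope classical_set_scope.
Variables (R : realType) (N : nat).
Hypothesis N_gt0 : (0 < N)%N.

Section Exact.
Variables (p mu : nat).
Hypothesis p_pr : prime p.
Hypothesis nE : logn p N = (2 * mu + 0)%N.
Hypothesis muE : mu = level N p.
Local Notation w := (w_cl R N (p ^ logn p N)).
Local Notation s := (S_cl R N (p ^ mu)).

Lemma local_group_muE : local_group R N p = gen [set w; s].
Proof. by rewrite muE. Qed.

Lemma exact_structure3 : (1 < p ^ mu <= 3)%N -> (w * s) ^+ 3 = 1 ->
  word_quads_distinct (p ^ mu) 1 (gen_quad p mu) (words0 (p ^ mu) ++ words1 (p ^ mu)) ->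
  uniq (words0 (p ^ mu) ++ words1 (p ^ mu)) ->
  presented2 w s (fun w s =>
    [set (w ^+ 2, 1); (s ^+ (p ^ mu), 1); ((w * s) ^+ 3, 1)]) /\
  (local_group R N p #= `I_(size (words0 (p ^ mu) ++ words1 (p ^ mu))))%card.
Proof.
move=> u3 ws3 dL uL; rewrite local_group_muE.
apply: (presented_exact N_gt0 p_pr nE muE (erefl _) _ ws3 dL uL) => U y w2 su ws.
by apply: words_ws3_le3 => //; rewrite expn_gt0 prime_gt0.
Qed.

End Exact.

Lemma structure3_2 : logn 3 N = 2%N ->
  [/\ local_group R N 3 = gen [set w_cl R N 9; S_cl R N 3],
      presented2 (w_cl R N 9) (S_cl R N 3) (fun w s =>
        [set (w ^+ 2, 1); (s ^+ 3, 1); ((w * s) ^+ 3, 1)])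
    & (local_group R N 3 #= `I_12)%card].
Proof.
move=> n2; have muE : 1%N = level N 3 by rewrite /level n2.
have nE : logn 3 N = (2 * 1 + 0)%N := n2.
have ws3 : (w_cl R N (3 ^ logn 3 N) * S_cl R N (3 ^ 1)) ^+ 3 = 1.
  by apply: (ws_cube R N_gt0 _ nE muE).
have [P C] := exact_structure3 (isT : prime 3) nE muE isT ws3 isT isT.
have := local_group_muE muE; rewrite n2 in P *.
by split.
Qed.

Lemma structure3_ge3 : (3 <= logn 3 N)%N ->
  let w := w_cl R N (3 ^ logn 3 N) in let s := S_cl R N 3 in
  [/\ local_group R N 3 = gen [set w; s],
      presented2 w s (fun w s =>
        [set (w ^+ 2, 1); (s ^+ 3, 1); (w * s * w * s, s * (w * s * w))])
    & (local_group R N 3 #= `I_18)%card].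
Proof.
move=> n3 w s; have muE : 1%N = level N 3.
  by rewrite /level; apply/esym/minn_idPl; rewrite (leq_trans _ (leq_div2r 2 n3)).
have nE : logn 3 N = (2 * 1 + (logn 3 N - 2))%N by rewrite subnKC // ltnW.
have nu_gt0 : (0 < logn 3 N - 2)%N by rewrite subn_gt0.
(* Any positive nu makes p^nu vanish modulo u = 3, which is why all exponents from 3 on behave
   alike. *)
have PE : 0 = 3 ^ (logn 3 N - 2) %[mod 3 ^ 1].
  by apply/esym/eqP; rewrite mod0n -/(dvdn _ _) dvdn_exp.
have w2 : w ^+ 2 = 1 by apply: w_cl_sqr.
have s3 : s ^+ 3 = 1 by apply: (shift_order R N_gt0 _ nE muE).
have c : commute s (w * s * w).
  by apply: (commute_shift_conj R N_gt0 _ nE muE PE).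
have sat : satisfies (fun b : bool => if b then s else w)
   [set (Gen false ^+ 2, 1 : gword bool); (Gen true ^+ 3, 1 : gword bool);
        (Gen false * Gen true * Gen false * Gen true,
         Gen true * (Gen false * Gen true * Gen false))].
  by apply/satisfies3; rewrite !gevalX /= w2 s3 c.
have [||U y|P C] := presented_higher N_gt0 (isT : prime 3) nE muE nu_gt0 PE sat => //.
  by move=> /satisfies3; rewrite !gevalX /= => -[-> -> c']; split=> //; exact: esym.
by split=> //; rewrite (local_group_muE muE).
Qed.

Section Prime2.
Local Notation w := (w_cl R N (2 ^ logn 2 N)).

Lemma structure2_even mu (u := (2 ^ mu)%N) (s := S_cl R N u) :
  logn 2 N = (2 * mu + 0)%N -> mu = level N 2 -> (0 < mu <= 3)%N ->
  [/\ local_group R N 2 = gen [set w; s],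
      [/\ w ^+ 2 = 1, s ^+ u = 1 & (w * s) ^+ 3 = 1],
      u <> 8%N -> presented2 w s (fun w s =>
        [set (w ^+ 2, 1); (s ^+ u, 1); ((w * s) ^+ 3, 1)])
    & [/\ u = 2%N -> (local_group R N 2 #= `I_6)%card,
          u = 4%N -> (local_group R N 2 #= `I_24)%card
        & u = 8%N -> (local_group R N 2 #= `I_96)%card]].
Proof.
rewrite {}/s {}/u => nE muE mu3; have p2 : prime 2 by [].
have w2 : w ^+ 2 = 1 by apply: w_cl_sqr.
have su := shift_order R N_gt0 p2 nE muE.
have ws3 : (w * S_cl R N (2 ^ mu)) ^+ 3 = 1.
  apply: (ws_cube R N_gt0 p2 nE muE (erefl _)).
  by move: mu3; clear; case: mu => [|[|[|[|]]]].
have GE : local_group R N 2 = gen [set w; S_cl R N (2 ^ mu)] := local_group_muE muE.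
split=> //.
(* Fixing mu makes u numeric, so the finite tests evaluate. The value mu = 3 contributes only its
   order. *)
all: case: mu nE muE mu3 su ws3 GE => [|[|[|[|//]]]] // nE muE _ su ws3 GE.
- by move=> _; have [] := exact_structure3 p2 nE muE isT ws3 isT isT.
- move=> _; have [] // := @presented_exact R N N_gt0 2 2 0 p2 nE muE (erefl _)
    (words0 4 ++ words1 4 ++ words_wssw 4).
  by move=> U y w2' su' ws'; exact: words_ws3_4.
- split=> // _; by have [] := exact_structure3 p2 nE muE isT ws3 isT isT.
- split=> // _; rewrite GE.
  have [] // := @presented_exact R N N_gt0 2 2 0 p2 nE muE (erefl _)
    (words0 4 ++ words1 4 ++ words_wssw 4).
  by move=> U y w2' su' ws'; exact: words_ws3_4.
- split=> // _; rewrite GE genE -[96%N]/(size words96).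
  apply: card_gen_normal_forms; last by [].
    exact: (word_prod_closed R N_gt0 p2 nE muE (erefl _) _ words96_closed).
  have inj := @word_prod_inj R N N_gt0 2 3 0 p2 nE muE (erefl _) words96 words96_distinct.
  exact: inj.
Qed.

(** Here (x y)^2 is its own inverse, so x y x y = y x y x. This brings u = 2 with nu = 1 under the
    commuting normal forms. *)
Lemma ws_fourth_commute (T : groupType) (x y : T) :
  x ^+ 2 = 1 -> y ^+ 2 = 1 -> (x * y) ^+ 4 = 1 -> commute y (x * y * x).
Proof.
move=> x2 y2 xy4; have xV : x^-1 = x by apply: mulg1_eq; rewrite -expg2.
have yV : y^-1 = y by apply: mulg1_eq; rewrite -expg2.
have : ((x * y) ^+ 2)^-1 = (x * y) ^+ 2 by apply: mulg1_eq; rewrite -expgnDr.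
by rewrite expg2 !invgM xV yV /commute !mulgA.
Qed.

Lemma structure2_odd mu (u := (2 ^ mu)%N) (s := S_cl R N u) :
  logn 2 N = (2 * mu + 1)%N -> mu = level N 2 -> (0 < mu <= 3)%N ->
  [/\ local_group R N 2 = gen [set w; s],
      [/\ w ^+ 2 = 1, s ^+ u = 1 & (w * s) ^+ 4 = 1]
    & u = 2%N -> presented2 w s (fun w s =>
        [set (w ^+ 2, 1); (s ^+ u, 1); ((w * s) ^+ 4, 1)])].
Proof.
rewrite {}/s {}/u => nE muE mu3; have p2 : prime 2 by [].
have w2 : w ^+ 2 = 1 by apply: w_cl_sqr.
have su := shift_order R N_gt0 p2 nE muE.
have PE : 2 = 2 ^ 1 %[mod 2 ^ mu] by [].
set s := S_cl R N (2 ^ mu) in su *.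
have ws4 : (w * s) ^+ 4 = 1.
  (* The blocks w s w, s w s w and s w w multiply to (w s)^4; P = 2 because nu = 1. *)
  have := @relation_from_quads R N N_gt0 2 mu 1 p2 nE muE 2 PE [:: (0, 1); (1, 1); (1, 0)]%N.
  move=> <-; last by move: mu3; clear; case: mu => [|[|[|[|]]]].
  rewrite !big_cons big_nil /= mulg1 !expg1 expg0 mul1g mulg1 -expg2 w2 mulg1.
  by rewrite !expgS expg0 mulg1 !mulgA.
split=> //; first exact: local_group_muE muE.
move=> u2; have mu1 : mu = 1%N by move: mu3 u2; clear; case: mu => [|[|[|[|]]]].
move: nE muE su ws4; rewrite /s mu1 => nE muE su ws4 {PE}.
have sat : satisfies (fun b : bool => if b then S_cl R N (2 ^ 1) else w)
   [set (Gen false ^+ 2, 1 : gword bool); (Gen true ^+ 2, 1 : gword bool);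
        ((Gen false * Gen true) ^+ 4, 1 : gword bool)].
  by apply/satisfies3; rewrite !gevalX /= w2 su ws4.
have PE : 0 = 2 ^ 1 %[mod 2 ^ 1] by [].
have [||U y|P C] := presented_higher N_gt0 p2 nE muE isT PE sat => //.
move=> /satisfies3; rewrite !gevalX /= => -[w2' su' ws4'].
by split=> //; exact: ws_fourth_commute.
Qed.

Lemma structure2_ge9 : (9 <= logn 2 N)%N ->
  [/\ local_group R N 2 = gen [set w; S_cl R N 8], w ^+ 2 = 1, S_cl R N 8 ^+ 8 = 1
    & commute (S_cl R N 8) (w * S_cl R N 8 * w)].
Proof.
move=> n9; have p2 : prime 2 by []; have muE : 3%N = level N 2.
  rewrite /level (_ : logn 2 24 = 3%N) //; apply/esym/minn_idPl.
  by rewrite (leq_trans _ (leq_div2r 2 n9)).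
have nE : logn 2 N = (2 * 3 + (logn 2 N - 6))%N by rewrite subnKC // (leq_trans _ n9).
(* The exponent 9 is the first with nu = 3, that is, with p^nu divisible by u = 8. *)
have PE : 0 = 2 ^ (logn 2 N - 6) %[mod 2 ^ 3].
  apply/esym/eqP; rewrite mod0n -/(dvdn _ _) dvdn_exp2l //.
  by rewrite leq_subRL // (leq_trans _ n9).
split; first exact: local_group_muE muE.
- exact: w_cl_sqr.
- exact: (shift_order R N_gt0 p2 nE muE).
- exact: (commute_shift_conj R N_gt0 p2 nE muE PE).
Qed.

Lemma structure2_8 (w256 := w_cl R N 256) (s := S_cl R N 8) : logn 2 N = 8%N ->
  [/\ local_group R N 2 = gen [set w256; s], w256 ^+ 2 = 1, s ^+ 8 = 1
    & w256 * s * w256 * s * w256 * s ^+ 3 * w256 * s ^+ 3 = 1].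
Proof.
move=> n8; have p2 : prime 2 by [].
have wE : w = w256 by rewrite n8.
have muE : 3%N = level N 2 by rewrite /level n8.
have nE : logn 2 N = (2 * 3 + 2)%N := n8.
have w2 : w256 ^+ 2 = 1 by rewrite -wE; apply: w_cl_sqr.
split=> //; first by rewrite -wE; exact: local_group_muE muE.
  exact: (shift_order R N_gt0 p2 nE muE).
(* The relator is cut into the blocks w s w, s w s^3 w and s^3 w w; P = 4 because nu = 2. *)
have := @relation_from_quads R N N_gt0 2 3 2 p2 nE muE 4 (erefl _)
  [:: (0, 1); (1, 3); (3, 0)]%N isT.
rewrite wE -/s => <-.
rewrite !big_cons big_nil /= mulg1 !expg1 expg0 mul1g mulg1 -expg2 w2 mulg1.
by rewrite !mulgA.
Qed.

End Prime2.

End Structure.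

Local Open Scope group_scope.
Local Open Scope classical_set_scope.

Theorem theorem16 (R : realType) (N : nat) (hN : (0 < N)%N) :
  let w := w_cl R N in
  let S := S_cl R N in
  exists G : nat -> set (NQuot R N),
  [/\ (* the quotient is the product of the subgroups *)
      forall x : NQuot R N, exists g : nat -> NQuot R N,
        [/\ G 2 (g 2), G 3 (g 3),
            forall q, prime q -> (5 <= q)%N -> (q %| N)%N -> G q (g q)
          & x = g 2 * g 3 * \prod_(q <- primes N | (5 <= q)%N) g q],
      (* (1) *)
      forall q, prime q -> (5 <= q)%N -> (q %| N)%N ->
        let wq := w (q ^ logn q N)%N in
        [/\ G q = gen [set wq], wq ^+ 2 = 1 & wq <> 1],
      (* (2) *)
      [/\ logn 3 N = 0%N -> G 3 = [set 1],
          logn 3 N = 1%N -> [/\ G 3 = gen [set w 3], w 3 ^+ 2 = 1 & w 3 <> 1],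
          logn 3 N = 2%N ->
            [/\ G 3 = gen [set w 9; S 3],
                presented2 (w 9) (S 3) (fun w s =>
                  [set (w ^+ 2, 1); (s ^+ 3, 1); ((w * s) ^+ 3, 1)])
              & (G 3 #= `I_12)%card]
        & (3 <= logn 3 N)%N ->
            let w3 := w (3 ^ logn 3 N)%N in
            [/\ G 3 = gen [set w3; S 3],
                presented2 w3 (S 3) (fun w s =>
                  [set (w ^+ 2, 1); (s ^+ 3, 1);
                       (w * s * w * s, s * (w * s * w))])
              & (G 3 #= `I_18)%card]]
    & (* (3) *)
      let lam := logn 2 N in
      let mu := minn 3 (lam %/ 2) in
      let u := (2 ^ mu)%N in
      let w2 := w (2 ^ lam)%N in
      [/\ lam = 0%N -> G 2 = [set 1],
          lam = 1%N -> [/\ G 2 = gen [set w 2], w 2 ^+ 2 = 1 & w 2 <> 1],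
          lam = (2 * mu)%N -> (2 <= lam <= 6)%N ->
            [/\ G 2 = gen [set w2; S u],
                [/\ w2 ^+ 2 = 1, S u ^+ u = 1 & (w2 * S u) ^+ 3 = 1],
                u <> 8%N -> presented2 w2 (S u) (fun w s =>
                  [set (w ^+ 2, 1); (s ^+ u, 1); ((w * s) ^+ 3, 1)])
              & [/\ u = 2%N -> (G 2 #= `I_6)%card, u = 4%N -> (G 2 #= `I_24)%card
                  & u = 8%N -> (G 2 #= `I_96)%card]]
        & [/\ (2 * mu < lam)%N -> (2 <= lam <= 7)%N ->
            [/\ G 2 = gen [set w2; S u],
                [/\ w2 ^+ 2 = 1, S u ^+ u = 1 & (w2 * S u) ^+ 4 = 1]
              & u = 2%N -> presented2 w2 (S u) (fun w s =>
                  [set (w ^+ 2, 1); (s ^+ u, 1); ((w * s) ^+ 4, 1)])],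
          (9 <= lam)%N ->
            [/\ G 2 = gen [set w2; S 8], w2 ^+ 2 = 1, S 8 ^+ 8 = 1
              & commute (S 8) (w2 * S 8 * w2)]
        & lam = 8%N ->
            [/\ G 2 = gen [set w 256; S 8], w 256 ^+ 2 = 1, S 8 ^+ 8 = 1
              & w 256 * S 8 * w 256 * S 8 * w 256 * S 8 ^+ 3 * w 256 * S 8 ^+ 3
                = 1]]]].
Proof.
have l2E : level N 2 = minn 3 (logn 2 N %/ 2) by rewrite /level (_ : logn 2 24 = 3%N).
move=> w S; exists (local_group R N); split.
- exact: product_decomposition.
- move=> q q_pr q5 qN; apply: level0_structure => //.
  by rewrite /level logn_24_ge5 // min0n.
- split.
  + exact: local_group_logn0.
  + exact: logn1_structure.
  + exact: structure3_2.
  + exact: structure3_ge3.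
- move=> lam mu u w2; have muE : mu = level N 2 by rewrite l2E.
  split.
  + exact: local_group_logn0.
  + exact: logn1_structure.
  + move=> lamE lam6; apply: structure2_even => //; first by rewrite addn0.
    by move: lam6; rewrite lamE; clearbody mu; clear; lia.
  + split; [|exact: structure2_ge9|exact: structure2_8].
    (* Since mu is capped at 3, the bound 7 is what excludes nu > 1. *)
    move=> mul lam7; have [lamE mu3] : lam = (2 * mu + 1)%N /\ (0 < mu <= 3)%N.
      by move: mul lam7; rewrite /mu; clearbody lam; clear; lia.
    exact: structure2_odd.
Qed.
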